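(* Assume the strictly tailored condition, $\lambda^\star<\lambda<1$ and $0<\delta<1$. A Borel stationary randomized strategy $\Pi$ is an MPE if and only if $$s_\alpha(z^*(\alpha))=1,\qquad\kappa_\alpha\big(\{\alpha^I(x):x\in\Gamma(\alpha)\}\big)=1\qquad\text{for every }\alpha\in\Delta^n.$$ For every such equilibrium, $S(\alpha)=G(\alpha)/(1-\delta)$ for every $\alpha$. From every initial state the consumer reaches a pure worldview in one period and remains there almost surely (almost surely $\alpha_1$ is a pure worldview and $\alpha_t=\alpha_1$ for all $t\ge1$). Randomization over future worldviews can occur only among the pure destinations $\alpha^I(x)$, $x\in\Gamma(\alpha)$.
   Context: $J=\{1,\ldots,n\}$ and $X$ are nonempty finite sets (pure worldviews and actions) with payoffs $u_j(x)\in\mathbb R$. $\Delta^n=\{\alpha\in\mathbb R^n:\alpha^j\ge0,\ \sum_j\alpha^j=1\}$; $\alpha(j)$ is the vertex with weight one on $j$ (pure worldview). $U(\alpha,x)=\sum_j\alpha^ju_j(x)$, $z^*(\alpha)=\arg\max_{x\in X}U(\alpha,x)$, $X^I=\bigcup_{\alpha\in\Delta^n}z^*(\alpha)$. Strictly tailored condition: for every $x\in X^I$ there is an index $i(x)\in J$ with $u_{i(x)}(x)>u_{i(x)}(y)$ for every $y\in X\setminus\{x\}$, and $u_{i(x)}(x)>u_j(x)$ for every $j\in J\setminus\{i(x)\}$. (The index is then unique and $x\mapsto i(x)$ is injective.) Write $\alpha^I(x)=\alpha(i(x))$. For distinct $x,y\in X^I$ put $D_{xy}=u_{i(x)}(x)-u_{i(x)}(y)>0$,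 $R_{xy}=u_{i(y)}(y)-u_{i(x)}(y)>0$, and $$\lambda^\star=\max\Big\{0,\max_{x,y\in X^I,\,x\ne y}\Big(1-\frac{D_{xy}}{R_{xy}}\Big)\Big\}\in[0,1),$$ with $\lambda^\star=0$ if $|X^I|=1$. For $x\in X^I$ put $g_x(\alpha)=(1-\lambda)u_{i(x)}(x)+\lambda U(\alpha,x)$, $G(\alpha)=\max_{x\in X^I}g_x(\alpha)$, $\Gamma(\alpha)=\arg\max_{x\in X^I}g_x(\alpha)$. A stationary randomized strategy is a Borel probability kernel $\alpha\mapsto\Pi_\alpha$ from $\Delta^n$ to $X\times\Delta^n$, with marginals $s_\alpha$ on $X$ and $\kappa_\alpha$ on $\Delta^n$. From a fixed $\alpha_0$, conditional on the history $(\alpha_0,x_0,\ldots,x_{t-1},\alpha_t)$, the pair $(x_t,\alpha_{t+1})$ has law $\Pi_{\alpha_t}$; $\mathbb E_\beta$ is expectation when $\alpha_0=\beta$. Put $$C_\Pi(\beta;\alpha)=\mathbb E_\beta\sum_{k=0}^\infty\delta^k\big[(1-\lambda)U(\alpha_k,x_k)+\lambda U(\alpha,x_k)\big],\qquad S(\alpha)=\int C_\Pi(\beta;\alpha)\,\kappa_\alpha(d\beta).$$ $\Pi$ is a stationary randomized MPE if for every $\alpha\in\Delta^n$: $s_\alpha(z^*(\alpha))=1$ and $S(\alpha)\ge C_\Pi(\gamma;\alpha)$ for every $\gamma\in\Delta^n$. *)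

(* Defs.v *)
From HB Require Import structures.
From mathcomp Require Import all_boot all_order all_algebra.
From mathcomp Require Import all_classical all_reals all_analysis.

Set Implicit Arguments.
Unset Strict Implicit.
Unset Printing Implicit Defensive.

Import Order.TTheory GRing.Theory Num.Theory.
Import numFieldNormedType.Exports.

Local Open Scope classical_set_scope.
Local Open Scope ring_scope.

(* A finite set [X] of actions with its discrete sigma-algebra.  Measurable
   types are pointed in the library, so the witness [x0] that [X] is nonempty
   is a parameter of the type; it plays no other role. *)
Definition action (X : finType) (x0 : X) : Type := X.

Section action_instances.
Variables (X : finType) (x0 : X).

HB.instance Definition _ := Finite.on (action x0).
HB.instance Definition _ := isPointed.Build (action x0) x0.
HB.instance Definition _ := @isMeasurable.Build default_measure_display
  (action x0) discrete_measurable discrete_measurable0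
  discrete_measurableC discrete_measurableU.

End action_instances.

(* The simplex Delta^n.  The nonempty index set {1, ..., n} is ['I_n.+1]. *)
Section worldview.
Variables (R : realType) (n : nat).

Definition simplex : set 'rV[R]_n.+1 :=
  [set a | (forall j, 0 <= a 0 j) /\ \sum_j a 0 j = 1].

Definition worldview : Type := set_type simplex.

Lemma simplex_vertex (j : 'I_n.+1) : (delta_mx 0 j : 'rV[R]_n.+1) \in simplex.
Proof.
apply/mem_set; split => [k|]; first by rewrite mxE ler0n.
rewrite (bigD1 j)//= big1 ?addr0 => [|k kj]; first by rewrite mxE !eqxx.
by rewrite mxE eqxx/= (negbTE kj).
Qed.

Definition vertex (j : 'I_n.+1) : worldview := 
  exist (fun a => a \in simplex) _ (simplex_vertex j).

Definition weight (a : worldview) (j : 'I_n.+1) : R := (\val a) 0 j.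

HB.instance Definition _ := Topological.copy worldview (set_type simplex).
HB.instance Definition _ := isPointed.Build worldview (vertex ord0).

(* The Borel sigma-algebra of the subspace topology inherited from R^n. *)
HB.instance Definition _ := @isMeasurable.Build
  (sigma_display (@open worldview)) worldview <<s @open worldview >>
  (@sigma_algebra0 _ setT (@open worldview)) (@sigma_algebraC _ (@open worldview))
  (@sigma_algebra_bigcup _ setT (@open worldview)).

End worldview.

Section payoffs.
Variables (R : realType) (n : nat) (X : finType).
Implicit Types (u : 'I_n.+1 -> X -> R) (i : X -> 'I_n.+1) (a : worldview R n).

Definition U u a (x : X) : R := \sum_j weight a j * u j x.

Definition zstar u a : {set X} := [set x | [forall y, U u a y <= U u a x]]%SET.

Definition XI u : {set X} := [set x | `[< exists a, x \in zstar u a >]]%SET.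

(* The index [i x] of an action [x] in [XI u] is given by a function [i]; its
   values outside [XI u] are irrelevant. *)
Definition strictly_tailored u i : Prop :=
  forall x, x \in XI u ->
    (forall y, y != x -> u (i x) y < u (i x) x) /\
    (forall j, j != i x -> u j x < u (i x) x).

Definition Dgap u i (x y : X) : R := u (i x) x - u (i x) y.
Definition Rgap u i (x y : X) : R := u (i y) y - u (i x) y.

Definition lambda_star u i : R :=
  \big[Num.max/0]_(x in XI u) \big[Num.max/0]_(y in XI u | y != x)
    (1 - Dgap u i x y / Rgap u i x y).

Definition alphaI i (x : X) : worldview R n := vertex R (i x).

Definition gval u i (lambda : R) (x : X) a : R :=
  (1 - lambda) * u (i x) x + lambda * U u a x.

(* A maximum: [XI u] is finite and nonempty. *)
Definition Gval u i (lambda : R) a : R :=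
  sup [set gval u i lambda x a | x in [set` XI u]].

Definition Gamma u i (lambda : R) a : {set X} :=
  [set x in XI u |
    [forall y in XI u, gval u i lambda y a <= gval u i lambda x a]]%SET.

End payoffs.

(* Sample paths of the process (alpha_t, x_t)_t, with the product
   sigma-algebra. *)
Section path.
Variables (R : realType) (n : nat) (X : finType) (x0 : X).

Definition sample_path : Type := nat -> worldview R n * action x0.

HB.instance Definition _ := Pointed.on sample_path.

Definition path_cylinders : set (set sample_path) :=
  \bigcup_t preimage_set_system setT (fun w : sample_path => w t) measurable.

HB.instance Definition _ := @isMeasurable.Build
  (sigma_display path_cylinders) sample_path <<s path_cylinders >>
  (@sigma_algebra0 _ setT path_cylinders) (@sigma_algebraC _ path_cylinders)
  (@sigma_algebra_bigcup _ setT path_cylinders).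

(* The sigma-algebra of the history (alpha_0, x_0, ..., x_{t-1}, alpha_t). *)
Definition history (t : nat) : set (set sample_path) :=
  <<s (\bigcup_(k in `I_t)
         preimage_set_system setT (fun w : sample_path => w k) measurable) `|`
      preimage_set_system setT (fun w : sample_path => (w t).1) measurable >>.

End path.

Section strategies.
Variables (R : realType) (n : nat) (X : finType) (x0 : X).

Definition strategy : Type :=
  R.-pker (worldview R n) ~> (action x0 * worldview R n)%type.

Implicit Type Pi : strategy.

Definition smarg Pi (a : worldview R n) : set (action x0) -> \bar R :=
  pushforward (Pi a) fst.

Definition kappa Pi (a : worldview R n) : set (worldview R n) -> \bar R :=
  pushforward (Pi a) snd.

(* [P] is a law of the process started at [b]: given the history up to
   [alpha_t], the pair (x_t, alpha_{t+1}) has law [Pi alpha_t]. *)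
Definition is_path_law Pi (b : worldview R n)
    (P : probability (sample_path R n x0) R) : Prop :=
  P [set w | (w 0%N).1 = b] = 1%E /\
  forall t A B, history t A -> measurable B ->
    P (A `&` [set w | B ((w t).2, (w t.+1).1)]) =
      (\int[P]_(w in A) Pi (w t).1 B)%E.

(* By the Ionescu-Tulcea theorem there is exactly one such law, so that [get]
   returns it. *)
Definition path_law Pi (b : worldview R n) : probability (sample_path R n x0) R :=
  get [set P | is_path_law Pi b P].

Variables (u : 'I_n.+1 -> X -> R) (lambda delta : R).

Definition payoff (a : worldview R n) (w : sample_path R n x0) : R :=
  limn (series (fun k => delta ^+ k *
    ((1 - lambda) * U u (w k).1 (w k).2 + lambda * U u a (w k).2))).

Definition Cval Pi (b a : worldview R n) : \bar R :=
  ('E_(path_law Pi b)[payoff a])%E.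

Definition Sval Pi (a : worldview R n) : \bar R :=
  (\int[kappa Pi a]_b Cval Pi b a)%E.

Definition is_MPE Pi : Prop :=
  forall a, smarg Pi a [set` zstar u a] = 1%E /\
    forall c, (Cval Pi c a <= Sval Pi a)%E.

End strategies.

(* Main.v *)
(* Compare [C(b; a)] with [G(a) / (1 - delta)]. Optimal actions are tailored,
   so the gain of any period is at most [G(a)], and it reaches [G(a)] only at
   a pure worldview [alphaI x] with [x] in [Gamma a]; hence [C(b; a) = G(a) /
   (1 - delta)] forces [b] to be such a worldview. At [e = alphaI x] the bound
   [lambda > lambda_star] gives [Gamma e = {x}], and the equilibrium condition
   [S(e) >= C(e; e) = G(e) + delta S(e)] makes [S(e)] attain its upper bound,
   so [e] is absorbing. Staying forever at [alphaI x] with [x] in [Gamma a]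
   then earns [G(a) / (1 - delta)] for every [a], and [S(a)] must match it,
   which leaves [kappa a] no mass outside the optimal pure worldviews.

   The law of the process exists by the Ionescu-Tulcea argument: were the
   content on cylinders not sigma-subadditive, the deficit could be kept
   positive along one trajectory, which would lie in a cylinder but in no
   member of its cover. *)
Require Import Defs.
From HB Require Import structures.
From mathcomp Require Import all_boot all_order all_algebra.
From mathcomp Require Import all_classical all_reals all_analysis.
From mathcomp Require Import measurable_realfun.
From mathcomp Require Import ring.
Set Implicit Arguments.
Unset Strict Implicit.
Unset Printing Implicit Defensive.
Import Order.TTheory GRing.Theory Num.Theory.
Import numFieldNormedType.Exports.
Local Open Scope classical_set_scope.
Local Open Scope ring_scope.

(** * The law of a homogeneous Markov chain *)

Section kernel_combinators.
Context d1 d2 d3 (X : measurableType d1) (Y : measurableType d2)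
  (Z : measurableType d3) (R : realType).

Section kcomap.
Variables (k : R.-pker Y ~> Z) (f : X -> Y).

(** The proof [mf] is an argument of the term so that the kernel instances can be inferred from
    it. *)
Definition kcomap (mf : measurable_fun [set: X] f) (x : X) :
  {measure set Z -> \bar R} := k (f x).

Hypothesis mf : measurable_fun [set: X] f.

Let kcomap_measurable A : measurable A ->
  measurable_fun [set: X] (kcomap mf ^~ A).
Proof.
move=> mA; apply: (measurableT_comp (f := k ^~ A)) mf.
exact: measurable_kernel.
Qed.

HB.instance Definition _ :=
  isKernel.Build _ _ _ _ _ (kcomap mf) kcomap_measurable.

Let kcomap_prob x : kcomap mf x [set: Z] = 1%E.
Proof. exact: prob_kernel. Qed.

HB.instance Definition _ :=
  Kernel_isProbability.Build _ _ _ _ _ (kcomap mf) kcomap_prob.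

End kcomap.

Section pkcomp.
Variables (l : R.-pker X ~> Y) (k : R.-pker (X * Y)%type ~> Z).

Definition pkcomp : X -> {measure set Z -> \bar R} := (l \; k)%E.

Let pkcomp_measurable A : measurable A -> measurable_fun [set: X] (pkcomp ^~ A).
Proof. by move=> mA; exact: measurable_fun_mkcomp_sfinite. Qed.

HB.instance Definition _ := isKernel.Build _ _ _ _ _ pkcomp pkcomp_measurable.

Let pkcomp_prob x : pkcomp x [set: Z] = 1%E.
Proof.
rewrite /pkcomp/= /kcomp; under eq_integral do rewrite prob_kernel.
by rewrite integral_cst// mul1e prob_kernel.
Qed.

HB.instance Definition _ :=
  Kernel_isProbability.Build _ _ _ _ _ pkcomp pkcomp_prob.

Lemma integral_pkcomp x (f : Z -> \bar R) :
  (forall z, 0 <= f z)%E -> measurable_fun [set: Z] f ->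
  (\int[pkcomp x]_z f z = \int[l x]_y \int[k (x, y)]_z f z)%E.
Proof. exact: integral_kcomp. Qed.

End pkcomp.
End kernel_combinators.

(** * Trajectories and events that depend on finitely many coordinates *)

Section trajectory.
Context d (Y : measurableType d).

Definition traj : Type := nat -> Y.

HB.instance Definition _ := Pointed.on traj.

Definition traj_cylinders : set (set traj) :=
  \bigcup_t preimage_set_system setT (fun w : traj => w t) measurable.

HB.instance Definition _ := @isMeasurable.Build
  (sigma_display traj_cylinders) traj <<s traj_cylinders >>
  (@sigma_algebra0 _ setT traj_cylinders) (@sigma_algebraC _ traj_cylinders)
  (@sigma_algebra_bigcup _ setT traj_cylinders).

Lemma measurable_coord t : measurable_fun [set: traj] (fun w : traj => w t).
Proof.
move=> _ B mB; rewrite setTI; apply: sub_sigma_algebra.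
by exists t => //; exists B => //; rewrite setTI.
Qed.

Lemma measurable_fun_traj d' (T : measurableType d') (f : T -> traj) :
  (forall t, measurable_fun [set: T] (fun x => f x t)) ->
  measurable_fun [set: T] f.
Proof.
move=> mf; apply: (@measurability _ _ _ _ _ _ traj_cylinders) => //.
move=> _ [_ [t _ [B mB <-]] <-]; rewrite setTI.
have := mf t measurableT _ mB; rewrite !setTI.
by congr measurable.
Qed.

Definition upd k (w : traj) (y : Y) : traj :=
  fun j => if j == k then y else w j.

Lemma measurable_upd k :
  measurable_fun [set: traj * Y] (fun p => upd k p.1 p.2).
Proof.
apply: measurable_fun_traj => t; rewrite /upd; case: eqP => _.
  exact: measurable_snd.
exact: measurableT_comp (measurable_coord t) measurable_fst.
Qed.

(** Stated by agreement of trajectories rather than as a preimage from a finite product, so that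
    raising [N] and Boolean operations need no reindexing. *)
Definition depends_upto (N : nat) (A : set traj) : Prop :=
  forall w w' : traj, (forall k, (k <= N)%N -> w k = w' k) -> A w -> A w'.

Lemma depends_uptoE N A w w' : depends_upto N A ->
  (forall k, (k <= N)%N -> w k = w' k) -> A w = A w'.
Proof.
move=> dA e; apply/propext; split; first exact: dA.
by apply: dA => k kN; rewrite e.
Qed.

Lemma depends_upto_le N M A :
  (N <= M)%N -> depends_upto N A -> depends_upto M A.
Proof.
by move=> NM dA w w' e; apply: (dA w) => k kN; apply: e; exact: leq_trans NM.
Qed.

Lemma depends_uptoC N A : depends_upto N A -> depends_upto N (~` A).
Proof. by move=> dA w w' e nA A'; apply/nA/(dA w') => // k kN; rewrite e. Qed.

Lemma depends_upto_bigcup N (F : (set traj)^nat) :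
  (forall n, depends_upto N (F n)) -> depends_upto N (\bigcup_n F n).
Proof. by move=> dF w w' e [n _ Fw]; exists n => //; exact: (dF n w). Qed.

Lemma depends_uptoU N A B :
  depends_upto N A -> depends_upto N B -> depends_upto N (A `|` B).
Proof.
by move=> dA dB w w' e [?|?]; [left; exact: (dA w)|right; exact: (dB w)].
Qed.

Lemma depends_uptoI N A B :
  depends_upto N A -> depends_upto N B -> depends_upto N (A `&` B).
Proof. by move=> dA dB w w' e [? ?]; split; [exact: (dA w)|exact: (dB w)]. Qed.

End trajectory.

Section extend.
Context d (Y : measurableType d) (R : realType) (K : R.-pker Y ~> Y).

(* [extend m k w] redraws the coordinates [k+1, ..., k+m] of [w] as a Markov
   chain started at [w k] and keeps all the other coordinates. *)
Fixpoint extend (m k : nat) : R.-pker (traj Y) ~> (traj Y) :=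
  if m is m'.+1 then
    pkcomp (kcomap K (measurable_coord k))
      (kcomap (extend m' k.+1) (measurable_upd k.+1))
  else kdirac (@measurable_id _ (traj Y) setT).

Lemma extend0 k w A : extend 0 k w A = \d_w A.
Proof. by []. Qed.

Lemma extendS m k w A : (extend m.+1 k w A =
  \int[K (w k)]_y extend m k.+1 (upd k.+1 w y) A)%E.
Proof. by []. Qed.

Lemma measurable_extend_upd m k (w : traj Y) A : measurable A ->
  measurable_fun [set: Y] (fun y => extend m k (upd k w y) A).
Proof.
move=> mA; apply: (measurableT_comp (f := extend m k ^~ A)).
  exact: measurable_kernel.
by apply: (measurableT_comp (measurable_upd k)) (pair1_measurable w).
Qed.
End extend.

(** * The content on cylinders and its sigma-subadditivity *)

Section cylinder_content.
Context d (Y : measurableType d) (R : realType) (K : R.-pker Y ~> Y).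
Implicit Types (w : traj Y) (A : set (traj Y)).

Lemma diracE_depends N A w w' : depends_upto N A ->
  (forall k, (k <= N)%N -> w k = w' k) -> \d_w A = \d_w' A :> \bar R.
Proof.
move=> dA e; have := depends_uptoE dA e.
rewrite /dirac !indicE => AE; congr ((nat_of_bool _)%:R%:E).
by apply/idP/idP => /set_mem Aw; apply/mem_set; rewrite ?AE// -AE.
Qed.

(** Only coordinates after [k] are redrawn, so membership in [A] is already settled by [w] and every
    kernel integrates a constant. *)
Lemma extend_past m k w A : depends_upto k A -> extend K m k w A = \d_w A.
Proof.
elim: m k w => [//|m IH] k w dA.
rewrite extendS (eq_integral (cst (\d_w A))) => [|y _].
  by rewrite integral_cst// prob_kernel mule1.
rewrite IH; last exact: depends_upto_le dA.
apply: diracE_depends dA _ => j jk; rewrite /upd ifF//.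
by apply/negbTE; rewrite neq_ltn ltnS jk.
Qed.

(** Consistency of the finite-dimensional laws: draws beyond coordinate [N] integrate out. *)
Lemma extend_level m m' k N w A : depends_upto N A ->
  (N <= k + m)%N -> (N <= k + m')%N -> extend K m k w A = extend K m' k w A.
Proof.
move=> dA; elim: m m' k w => [|m IH] [|m'] k w.
- by [].
- by rewrite addn0 => Nk _; rewrite !extend_past//; exact: depends_upto_le dA.
- by rewrite addn0 => _ Nk; rewrite !extend_past//; exact: depends_upto_le dA.
- move=> Nm Nm'; rewrite !extendS; apply: eq_integral => y _.
  by apply: IH; rewrite addSnnS.
Qed.

(** By [extend_level] the sequence is eventually constant when [A] depends on finitely many
    coordinates; taking the limit spares the choice of a level for [A]. *)
Definition cylinder_prob k w A : \bar R := limn (fun m => extend K m k w A).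

Lemma cvg_cylinder_prob N k w A : depends_upto N A ->
  (fun m => extend K m k w A) @ \oo --> cylinder_prob k w A.
Proof.
move=> dA; apply/cvg_ex; exists (extend K N k w A).
apply: cvg_near_cst; exists N => // m /= Nm.
by apply: extend_level dA _ _; rewrite ?leq_addl// (leq_trans Nm)// leq_addl.
Qed.

Lemma cylinder_probE m N k w A : depends_upto N A -> (N <= k + m)%N ->
  cylinder_prob k w A = extend K m k w A.
Proof.
move=> dA Nkm; apply: cvg_lim => //.
apply: cvg_near_cst; exists m => // j /= mj.
by apply: extend_level dA _ _; rewrite // (leq_trans Nkm)// leq_add2l.
Qed.

Lemma cylinder_prob_ge0 N k w A :
  depends_upto N A -> (0 <= cylinder_prob k w A)%E.
Proof. by move=> dA; rewrite (cylinder_probE (m := N) (N := N))// leq_addl. Qed.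

Lemma cylinder_prob_past k w A :
  depends_upto k A -> cylinder_prob k w A = \d_w A.
Proof. by move=> dA; rewrite (cylinder_probE (m := 0) (N := k))// addn0. Qed.

Lemma cylinder_prob_step N k w A : depends_upto N A ->
  cylinder_prob k w A =
  (\int[K (w k)]_y cylinder_prob k.+1 (upd k.+1 w y) A)%E.
Proof.
move=> dA; rewrite (cylinder_probE (m := N.+1) (N := N))//; last first.
  by rewrite addnS leqW// leq_addl.
rewrite extendS; apply: eq_integral => y _.
by rewrite (cylinder_probE (m := N) (N := N))// leq_addl.
Qed.

Lemma measurable_cylinder_prob N k w A : measurable A -> depends_upto N A ->
  measurable_fun [set: Y] (fun y => cylinder_prob k (upd k w y) A).
Proof.
move=> mA dA; apply: eq_measurable_fun (measurable_extend_upd K N k w mA).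
by move=> y _; rewrite (cylinder_probE (m := N) (N := N))// leq_addl.
Qed.

(** A copy of [traj Y] that carries the algebra of cylinders instead of the sigma-algebra generated
    by it. *)
Definition cylinder_traj : Type := traj Y.

HB.instance Definition _ := Pointed.on cylinder_traj.

Definition cylinders : set (set cylinder_traj) :=
  [set A | measurable (A : set (traj Y)) /\ exists N, depends_upto N A].

Let cylinders0 : cylinders set0.
Proof. by split => //; exists 0%N. Qed.

Let cylindersU : setU_closed cylinders.
Proof.
move=> A B [mA [N dA]] [mB [M dB]]; split; first exact: measurableU.
exists (maxn N M); apply: depends_uptoU.
  exact: depends_upto_le (leq_maxl _ _) dA.
exact: depends_upto_le (leq_maxr _ _) dB.
Qed.

Let cylindersC : setC_closed cylinders.
Proof.
move=> A [mA [N dA]]; split; first exact: measurableC.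
by exists N; exact: depends_uptoC.
Qed.

HB.instance Definition _ := @isAlgebraOfSets.Build
  (sigma_display cylinders) cylinder_traj cylinders
  cylinders0 cylindersU cylindersC.

Variable y0 : Y.

(** The default 0 keeps the content nonnegative on every set, even where the limit in
    [cylinder_prob] may fail to exist. *)
Definition trajectory_content (A : set cylinder_traj) : \bar R :=
  if pselect (cylinders A) then cylinder_prob 0 (fun=> y0) A else 0%E.

Lemma trajectory_contentE A : cylinders A ->
  trajectory_content A = cylinder_prob 0 (fun=> y0) A.
Proof. by rewrite /trajectory_content; case: pselect. Qed.

Let trajectory_content_ge0 A : (0 <= trajectory_content A)%E.
Proof.
rewrite /trajectory_content; case: pselect => [cA|//]; have [_ [N dA]] := cA.
exact: cylinder_prob_ge0 dA.
Qed.

(** Each [extend K m] is a measure, and finite sums of nonnegative terms commute with the limit in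
    [m]. *)
Let trajectory_content_semi_additive :
  measure_function.semi_additive trajectory_content.
Proof.
move=> F n mF tF mUF; rewrite trajectory_contentE//.
transitivity (\sum_(i < n) cylinder_prob 0 (fun=> y0) (F i))%E; last first.
  by apply: eq_bigr => i _; rewrite trajectory_contentE//; exact: mF.
have cF : (fun m => \sum_(i < n) extend K m 0 (fun=> y0) (F i))%E @ \oo -->
    (\sum_(i < n) cylinder_prob 0 (fun=> y0) (F i))%E.
  apply: cvg_nnesum => [i _|i _].
    by apply: nearW => m; exact: measure_ge0.
  by have [_ [M dF]] := mF i; exact: cvg_cylinder_prob dF.
apply: cvg_lim => //.
apply: cvg_trans cF; apply: near_eq_cvg; apply: nearW => m.
rewrite measure_semi_additive//.
- by move=> i; have [] := mF i.
- by have [] := mUF.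
Qed.

HB.instance Definition _ := isContent.Build _ _ _ trajectory_content
  trajectory_content_ge0 trajectory_content_semi_additive.

(** Contrapositive: if the sum dominated at every [y], integrating over [K (w k)] and exchanging sum
    and integral would make it dominate at [w]. *)
Lemma cylinder_prob_deficit A (F : (set (traj Y))^nat) k w :
  cylinders A -> (forall i, cylinders (F i)) ->
  (\sum_(i <oo) cylinder_prob k w (F i) < cylinder_prob k w A)%E ->
  exists y, (\sum_(i <oo) cylinder_prob k.+1 (upd k.+1 w y) (F i) <
             cylinder_prob k.+1 (upd k.+1 w y) A)%E.
Proof.
move=> [mA [N dA]] cF; apply: contraPP => /forallNP noy.
apply/negP; rewrite -leNgt (cylinder_prob_step _ _ dA).
have F0 i j v : (0 <= cylinder_prob j v (F i))%E.
  by have [_ [M dF]] := cF i; exact: cylinder_prob_ge0 dF.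
have mF i : measurable_fun [set: Y]
    (fun y => cylinder_prob k.+1 (upd k.+1 w y) (F i)).
  by have [mF [M dF]] := cF i; exact: measurable_cylinder_prob dF.
rewrite (eq_eseriesr (g := fun i =>
  \int[K (w k)]_y cylinder_prob k.+1 (upd k.+1 w y) (F i))%E); last first.
  by move=> i _; have [_ [M dF]] := cF i; exact: cylinder_prob_step dF.
rewrite -integral_nneseries//.
apply: ge0_le_integral => //.
- by move=> y _; exact: cylinder_prob_ge0 dA.
- exact: measurable_cylinder_prob dA.
- exact: ge0_emeasurable_sum.
- by move=> y _; rewrite leNgt; apply/negP/noy.
Qed.

(* If the cover had smaller total mass, the deficit could be propagated along
   a single trajectory, one coordinate at a time; that trajectory lies in [A]
   but in no [F i]. *)
Let trajectory_content_sigma_subadditive :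
  measurable_subset_sigma_subadditive trajectory_content.
Proof.
move=> A F cF cA AF; rewrite leNgt; apply/negP.
rewrite trajectory_contentE//.
rewrite (eq_eseriesr (fun i _ => trajectory_contentE (cF i))).
move=> deficit.
pose D k w := (\sum_(i <oo) cylinder_prob k w (F i) < cylinder_prob k w A)%E.
(* The implication makes [next] total; [y0] is its value where there is no deficit to propagate. *)
have /choice[next nextP] (kw : nat * traj Y) :
    exists y, D kw.1 kw.2 -> D kw.1.+1 (upd kw.1.+1 kw.2 y).
  have [Dkw|nD] := pselect (D kw.1 kw.2); last by exists y0.
  by have [y Dy] := cylinder_prob_deficit cA cF Dkw; exists y.
pose W := fix W k := if k is k'.+1 then upd k'.+1 (W k') (next (k', W k'))
                     else (fun=> y0) : traj Y.
have DW k : D k (W k) by elim: k => [//|k IH]; exact: (nextP (k, W k)).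
(* Step [k] writes only coordinate [k], so the diagonal agrees with [W k] up to [k]. *)
pose w : traj Y := fun k => W k k.
have Ww k j : (j <= k)%N -> W k j = w j.
  elim: k => [|k IH]; first by rewrite leqn0 => /eqP ->.
  by rewrite leq_eqVlt => /predU1P[->//|jk]; rewrite /= /upd ltn_eqF// IH.
have [_ [N dA]] := cA.
have F0 i k v : (0 <= cylinder_prob k v (F i))%E.
  by have [_ [M dF]] := cF i; exact: cylinder_prob_ge0 dF.
(* At level [N] the content of [A] is its indicator at [w]; exceeding a nonnegative sum, it must be
   1. *)
have wA : A w.
  have := DW N; rewrite /D (cylinder_prob_past _ dA).
  rewrite (diracE_depends dA (Ww N)) diracE.
  have [/set_mem//|_] := boolP (w \in A).
  by rewrite ltNge nneseries_ge0.
have [i _ wF] := AF _ wA.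
have [_ [M dF]] := cF i.
(* At a level past both [N] and [M], the term of [F i] alone is 1 and so already bounds the
   indicator of [A], against the deficit. *)
have NM : (N <= maxn N M)%N by exact: leq_maxl.
have MM : (M <= maxn N M)%N by exact: leq_maxr.
have := DW (maxn N M).
rewrite /D (cylinder_prob_past _ (depends_upto_le NM dA)).
apply/negP; rewrite -leNgt; apply: (@le_trans _ _ 1%E).
  by rewrite diracE lee_fin lern1 leq_b1.
apply: (@le_trans _ _ (cylinder_prob (maxn N M) (W (maxn N M)) (F i))).
  rewrite (cylinder_prob_past _ (depends_upto_le MM dF)).
  rewrite (diracE_depends (depends_upto_le MM dF) (Ww _)) diracE.
  by rewrite mem_set.
rewrite (nneseries_split 0 i.+1)//.
rewrite big_mkord big_ord_recr/= addeAC leeDr// adde_ge0// ?sume_ge0//.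
by rewrite nneseries_ge0.
Qed.

HB.instance Definition _ := Content_SigmaSubAdditive_isMeasure.Build _ _ _
  trajectory_content trajectory_content_sigma_subadditive.

End cylinder_content.

Section pushforward_probability.
Context d1 d2 (X : measurableType d1) (Y : measurableType d2) (R : realType).
Variables (mu : {measure set X -> \bar R}) (f : X -> Y).
Hypotheses (mu1 : mu [set: X] = 1%E) (mf : measurable_fun [set: X] f).

Definition pushprob of mu [set: X] = 1%E & measurable_fun [set: X] f :
  set Y -> \bar R := pushforward mu f.

HB.instance Definition _ := Measure.copy (pushprob mu1 mf)
  (@measure_function_pushforward__canonical__measure_function_Measure
     _ _ _ _ _ mu f mf).

Let pushprob_setT : pushprob mu1 mf [set: Y] = 1%E.
Proof. by rewrite /pushprob /pushforward preimage_setT. Qed.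

HB.instance Definition _ :=
  Measure_isProbability.Build _ _ _ (pushprob mu1 mf) pushprob_setT.

Lemma integral_pushprob (h : Y -> \bar R) :
  measurable_fun [set: Y] h -> (forall y, 0 <= h y)%E ->
  (\int[pushprob mu1 mf]_y h y = \int[mu]_x h (f x))%E.
Proof. by move=> mh h0; rewrite /pushprob (ge0_integral_pushforward mf). Qed.

End pushforward_probability.

(** * From the content to a probability with the Markov property *)

Section trajectory_law.
Context d (Y : measurableType d) (R : realType) (K : R.-pker Y ~> Y).
Implicit Types (w : traj Y) (A : set (traj Y)).

Lemma measurable_kernel_coord j (D : set (traj Y)) B : measurable B ->
  measurable_fun D (fun v : traj Y => K (v j) B).
Proof.
move=> mB; apply: (measurableT_comp (f := K ^~ B)).
  exact: measurable_kernel.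
by apply: measurable_funTS; exact: measurable_coord.
Qed.

(** Induction on [m], integrating both sides over the next coordinate. With [m = 0] the event [A] is
    settled by [w], so its indicator factors out of the single draw. *)
Lemma extend_markov m k w A B : measurable A -> depends_upto (k + m) A ->
  measurable B ->
  extend K m.+1 k w (A `&` [set v | B (v (k + m).+1)]) =
  (\int[extend K m k w]_(v in A) K (v (k + m)%N) B)%E.
Proof.
move=> mA dA mB.
elim: m k w dA => [|m IH] k w dA.
  rewrite addn0 in dA *.
  rewrite [RHS]integral_dirac//; last exact: measurable_kernel_coord.
  transitivity (\d_w A * \int[K (w k)]_y (\1_B y)%:E)%E; last first.
    by rewrite integral_indic// setIT.
  rewrite extendS -ge0_integralZl//; last first.
    exact/measurable_EFinP/measurable_indic.
  apply: eq_integral => y _; rewrite extend0.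
  rewrite (diracE_depends (w := w) (w' := upd k.+1 w y) R dA); last first.
    by move=> j jk; rewrite /upd ltn_eqF.
  rewrite !diracE indicE -EFinM -natrM mulnb in_setI.
  congr ((nat_of_bool (_ && _))%:R%:E).
  by apply/idP/idP => /set_mem /= Bx; apply/mem_set; move: Bx;
    rewrite /= /upd eqxx.
rewrite extendS integral_mkcond [RHS]integral_mkcond.
rewrite [RHS]integral_pkcomp; last 2 first.
- by move=> v; rewrite patchE; case: ifP.
- by apply/(measurable_restrictT _ mA); exact: measurable_kernel_coord.
rewrite patch_setT; apply: eq_integral => y _.
by rewrite -integral_mkcond addnS -addSn IH// addSnnS.
Qed.

Definition freeze N (w : traj Y) : traj Y := fun j => w (minn j N).

Lemma measurable_freeze N : measurable_fun [set: traj Y] (@freeze N).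
Proof. by apply: measurable_fun_traj => t; exact: measurable_coord. Qed.

Lemma depends_upto_freeze N A : depends_upto N (@freeze N @^-1` A).
Proof.
move=> w w' e; rewrite /preimage/= (_ : freeze N w = freeze N w')//.
by apply/funext => j; rewrite /freeze e// geq_minr.
Qed.

(** The measures are compared only on events depending on coordinates up to [N]. Pushing both
    forward along [freeze N] leaves the integrals unchanged and pulls every measurable set back to
    such an event. *)
Lemma eq_integral_depends N (m1 m2 : {measure set (traj Y) -> \bar R})
    (A : set (traj Y)) (f : traj Y -> \bar R) :
  (forall B, measurable B -> depends_upto N B -> m1 B = m2 B) ->
  measurable A -> depends_upto N A ->
  measurable_fun A f -> (forall w, (0 <= f w)%E) ->
  (forall w, f (freeze N w) = f w) ->
  (\int[m1]_(w in A) f w = \int[m2]_(w in A) f w)%E.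
Proof.
move=> m12 mA dA mf f0 fN.
have mN := measurable_freeze N.
have AN : @freeze N @^-1` A = A.
  apply/funext => w; apply: depends_uptoE dA _ => k kN.
  by rewrite /freeze (minn_idPl kN).
have int_push (m : {measure set (traj Y) -> \bar R}) :
    (\int[m]_(w in A) f w = \int[pushforward m (freeze N)]_(w in A) f w)%E.
  rewrite (ge0_integral_pushforward mN)// ?AN.
  by apply: eq_integral => w _ /=; rewrite fN.
rewrite (int_push m1) (int_push m2); apply: eq_measure_integral => B mB _.
rewrite /= /pushforward m12//; last exact: depends_upto_freeze.
by rewrite -[X in measurable X]setTI; exact: mN.
Qed.

(** The Caratheodory extension of the content, transported along the identity from the sigma-algebra
    generated by cylinders to the one generated by coordinates. *)
Theorem exists_trajectory_law y0 : exists P : probability (traj Y) R,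
  (forall B, measurable B -> P [set w | B (w 0)] = \d_y0 B) /\
  (forall t A B, measurable A -> depends_upto t A -> measurable B ->
     P (A `&` [set w | B (w t.+1)]) = (\int[P]_(w in A) K (w t) B)%E).
Proof.
pose mu := @measure_extension _ _ _ (trajectory_content K y0).
have mid : measurable_fun [set: g_sigma_algebraType
    (@measurable _ (cylinder_traj Y))] (id : _ -> traj Y).
  apply: (@measurable_fun_traj _ _ _ _ _) => t _ B mB.
  rewrite setTI; apply: sub_sigma_algebra; split.
    by rewrite -[X in measurable X]setTI; exact: measurable_coord.
  by exists t => w w' e; rewrite /= e.
have muE N A : measurable A -> depends_upto N A ->
    mu A = extend K N 0 (fun=> y0) A.
  move=> mA dA; have cA : cylinders A by split => //; exists N.
  rewrite /mu /measure_extension measurable_mu_extE//=.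
  by rewrite trajectory_contentE// (@cylinder_probE _ _ _ _ N N).
have mu1 : mu setT = 1%E by rewrite (muE 0%N)// prob_kernel.
pose P : probability (traj Y) R := pushprob mu1 mid.
have PN N A : measurable A -> depends_upto N A ->
    P A = extend K N 0 (fun=> y0) A.
  exact: muE.
have mB t B : measurable B -> measurable [set w : traj Y | B (w t)].
  by move=> mB; rewrite -[X in measurable X]setTI; exact: measurable_coord.
exists P; split => [B mB'|t A B mA dA mB'].
  rewrite (PN 0%N)//; first exact: mB.
  by move=> w w' e; rewrite /= e.
rewrite (PN t.+1); last 2 first.
- by apply: measurableI => //; exact: mB.
- apply: depends_uptoI; first exact: depends_upto_le dA.
  by move=> w w' e; rewrite /= e.
rewrite (extend_markov (k := 0))//; apply: eq_integral_depends dA _ _ _ => //.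
- by move=> C mC dC; rewrite [RHS](PN t).
- exact: measurable_kernel_coord.
- by move=> w; rewrite /freeze add0n minnn.
Qed.

End trajectory_law.

(** * Sample paths of a strategy *)

Section worldview_measurability.
Variables (R : realType) (n : nat).

Lemma measurable_weight j :
  measurable_fun [set: worldview R n] (fun a => weight a j).
Proof.
apply: (measurability _ (RGenOInfty.measurableE R)) => //.
move=> _ [_ [r ->] <-]; rewrite setTI; apply: sub_sigma_algebra.
have cw : continuous (fun a : worldview R n => weight a j).
  move=> a; apply: (@continuous_comp _ _ _ (fun a : worldview R n => \val a)
    (fun v : 'rV[R]_n.+1 => v 0 j)).
    exact: (@initial_continuous (set_type (@simplex R n)) _ set_val).
  exact: coord_continuous.
by move/continuousP: cw; apply; exact: interval_open.
Qed.

Lemma worldview_eqP (a b : worldview R n) :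
  (forall j, weight a j = weight b j) -> a = b.
Proof.
move=> ab; apply/val_inj/matrixP => k j.
by rewrite !ord1; exact: ab.
Qed.

(** Singletons are finite intersections of level sets of the weights. This makes initial-state
    events and finite sets of destinations measurable. *)
Lemma measurable_worldview1 (b : worldview R n) : measurable [set b].
Proof.
rewrite (_ : [set b] = \bigcap_(j in [set: 'I_n.+1])
    ((fun a => weight a j) @^-1` [set weight b j])); last first.
  apply/seteqP; split => [a -> j _ //|a ab].
  by apply: worldview_eqP => j; exact: ab.
apply: fin_bigcap_measurable => // j _.
by rewrite -[X in measurable X]setTI; exact: measurable_weight.
Qed.

Lemma measurable_image_fintype (T : finType) (f : T -> worldview R n)
    (A : set T) :
  measurable (f @` A).
Proof.
apply: countable_measurable; last exact: (sub_countable (card_image_le _ _)).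
exact: measurable_worldview1.
Qed.

End worldview_measurability.

(** * Existence of the law of a strategy's sample paths *)

Section path_law_existence.
Variables (R : realType) (n : nat) (X : finType) (x0 : X).
Implicit Types (Pi : strategy R n x0) (b : worldview R n).

Local Notation path := (sample_path R n x0).

Lemma measurable_next_worldview (B : set (worldview R n)) : measurable B ->
  measurable [set p : action x0 * worldview R n | B p.2].
Proof.
by move=> mB; rewrite -[X in measurable X]setTI; exact: measurable_snd.
Qed.

Lemma measurable_path_coord t :
  measurable_fun [set: path] (fun w : path => w t).
Proof.
move=> _ B mB; rewrite setTI; apply: sub_sigma_algebra.
by exists t => //; exists B => //; rewrite setTI.
Qed.

Lemma history_measurable t (A : set path) : history t A -> measurable A.
Proof.
apply: smallest_sub; first exact: sigma_algebra_measurable.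
move=> B [[k _ [C mC <-]]|[C mC <-]].
  exact: measurable_path_coord.
have mf : measurable_fun [set: path] (fun w : path => (w t).1).
  exact: (measurableT_comp measurable_fst (measurable_path_coord t)).
exact: mf.
Qed.

Lemma history_state t (B : set (worldview R n)) : measurable B ->
  history t [set w : path | B (w t).1].
Proof.
by move=> mB; apply: sub_sigma_algebra; right; exists B => //; rewrite setTI.
Qed.

(* The pairs [(x_{t-1}, alpha_t)] form a Markov chain, whereas a sample path
   lists the pairs [(alpha_t, x_t)]; in the chain, [x_{-1}] is a dummy. *)
Definition regroup (y : traj (action x0 * worldview R n)%type) : path :=
  fun t => ((y t).2, (y t.+1).1).

Lemma measurable_regroup : measurable_fun setT regroup.
Proof.
apply: (@measurability _ _ _ _ _ _ (@path_cylinders R n X x0)) => //.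
move=> _ [_ [t _ [B mB <-]] <-]; rewrite setTI.
have mt : measurable_fun setT (fun y => regroup y t).
  apply/measurable_fun_pairP; split.
    exact: (measurableT_comp measurable_snd (measurable_coord t)).
  exact: (measurableT_comp measurable_fst (measurable_coord t.+1)).
have := mt measurableT _ mB; rewrite !setTI.
by congr measurable.
Qed.

(** In the chain, [alpha_t] sits in coordinate [t] and [x_k] in coordinate [k+1]; since histories
    use [x_k] only for [k < t], nothing beyond coordinate [t] is read. *)
Lemma history_depends t (A : set path) : history t A ->
  depends_upto t (regroup @^-1` A).
Proof.
move: A; suff : history t `<=`
    [set A : set path | depends_upto t (regroup @^-1` A)] by exact.
apply: smallest_sub.
  split => [|C dC|F dF]; first by [].
    by rewrite setTD preimage_setC; exact: depends_uptoC.
  by rewrite /= preimage_bigcup; exact: depends_upto_bigcup.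
move=> B [[k /= kt [C mC <-]]|[C mC <-]] w w' e [_ Cw]; split => //=.
  by move: Cw; rewrite /regroup /= e ?(ltnW kt)// e.
by move: Cw; rewrite /regroup /= e.
Qed.

Theorem exists_path_law Pi b : exists P, is_path_law Pi b P.
Proof.
(* The next pair depends on the current one only through its worldview component. *)
pose K := kcomap Pi (@measurable_snd _ _ (action x0) (worldview R n)).
have [Q [Q0 QS]] := exists_trajectory_law K (x0, b).
exists (pushprob (probability_setT Q) measurable_regroup); split.
  rewrite [LHS](Q0 [set y | y.2 = b]).
    by rewrite diracE mem_set.
  exact: measurable_next_worldview (measurable_worldview1 b).
move=> t A B hA mB; have mA := history_measurable hA.
have mregA : measurable (regroup @^-1` A).
  by rewrite -[X in measurable X]setTI; exact: measurable_regroup.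
have mP : measurable_fun A (fun w : path => Pi (w t).1 B).
  apply: measurable_funTS; apply: (measurableT_comp (f := Pi ^~ B)).
    exact: measurable_kernel.
  exact: (measurableT_comp measurable_fst (measurable_path_coord t)).
rewrite [RHS](ge0_integral_pushforward measurable_regroup)//.
rewrite -[RHS](QS t _ B mregA (history_depends hA) mB).
congr (Q _); apply/seteqP.
by split => y /= [Ay]; rewrite -surjective_pairing.
Qed.

Lemma path_lawP Pi b : is_path_law Pi b (path_law Pi b).
Proof.
exact: (@getPex _ [set P | is_path_law Pi b P] (exists_path_law Pi b)).
Qed.

End path_law_existence.

(** * Almost-sure statements and bounded integrals under a probability *)

Section probability_lemmas.
Context d (T : measurableType d) (R : realType) (P : probability T R).

Lemma probability1_ae (E : set T) :
  measurable E -> P E = 1%E -> {ae P, forall w, E w}.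
Proof.
move=> mE PE; exists (~` E); split => //; first exact: measurableC.
by rewrite probability_setC// PE subee.
Qed.

Lemma ae_probability1 (E : set T) :
  measurable E -> {ae P, forall w, E w} -> P E = 1%E.
Proof.
move=> mE aeE; have mCE : measurable (~` E) by exact: measurableC.
rewrite -[E in LHS]setCK probability_setC// (measure_negligible mCE)//.
by rewrite sube0.
Qed.

Lemma bounded_integrable (f : T -> \bar R) (b : R) :
  measurable_fun [set: T] f -> (forall x, 0 <= f x <= b%:E)%E ->
  P.-integrable [set: T] f.
Proof.
move=> mf fb.
have ib : P.-integrable setT (EFin \o cst b).
  exact: finite_measure_integrable_cst.
apply: (le_integrable measurableT mf _ ib) => x _.
have /andP[f0 fxb] := fb x.
by rewrite (gee0_abs f0) (le_trans fxb)//= lee_fin ler_norm.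
Qed.

Lemma probability_integral_cst (c : \bar R) : (\int[P]_x c = c)%E.
Proof.
rewrite integral_cst// -[RHS]mule1; congr (_ * _)%E.
exact: probability_setT.
Qed.

Lemma integral_subr_cst (f : T -> \bar R) (b c : R) :
  measurable_fun [set: T] f -> (forall x, 0 <= f x <= b%:E)%E ->
  (\int[P]_x (f x - c%:E) = \int[P]_x f x - c%:E)%E.
Proof.
move=> mf fb; have fi := bounded_integrable mf fb.
have ic : P.-integrable setT (EFin \o cst c).
  exact: finite_measure_integrable_cst.
rewrite (integralB _ fi ic)//; congr (_ - _)%E.
exact: (probability_integral_cst c%:E).
Qed.

(** The gap [b - f] is nonnegative with integral at most 0, hence vanishes almost everywhere. *)
Lemma ae_eq_bound (f : T -> \bar R) (b : R) :
  measurable_fun [set: T] f -> (forall x, 0 <= f x <= b%:E)%E ->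
  (b%:E <= \int[P]_x f x)%E -> {ae P, forall x, f x = b%:E}.
Proof.
move=> mf fb bf; have fi := bounded_integrable mf fb.
have ib : P.-integrable setT (EFin \o cst b).
  exact: finite_measure_integrable_cst.
have g0 x : (0 <= b%:E - f x)%E.
  by have /andP[f0 fxb] := fb x; rewrite subre_ge0.
have mg : measurable_fun [set: T] (fun x => b%:E - f x)%E.
  exact: emeasurable_funB.
have Ig : (\int[P]_x `|b%:E - f x| = 0)%E.
  under eq_integral do rewrite gee0_abs//.
  apply/eqP; rewrite eq_le integral_ge0// andbT.
  rewrite (integralB _ ib fi)// [X in (X - _)%E](probability_integral_cst b%:E).
  by rewrite sube_le0.
have /(ae_eq_integral_abs P measurableT mg) := Ig.
apply: filterS => x /(_ Logic.I) /= /eqP.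
have /andP[f0 fxb] := fb x.
have ffin : f x \is a fin_num.
  by rewrite ge0_fin_numE// (le_lt_trans fxb)// ltry.
by rewrite sube_eq ?fin_num_adde_defl// add0e => /eqP ->.
Qed.

End probability_lemmas.

(** * One-step transitions and the marginal laws of the state *)

Section one_step.
Variables (R : realType) (n : nat) (X : finType) (x0 : X).
Variable (Pi : strategy R n x0).
Implicit Types (b : worldview R n) (P : probability (sample_path R n x0) R).
Local Open Scope ereal_scope.
Local Notation path := (sample_path R n x0).
Local Notation A := (action x0).
Local Notation W := (worldview R n).

Lemma measurable_state t : measurable_fun [set: path] (fun w : path => (w t).1).
Proof. exact: (measurableT_comp measurable_fst (measurable_path_coord t)). Qed.

Lemma measurable_choice t :
  measurable_fun [set: path] (fun w : path => (w t).2).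
Proof. exact: (measurableT_comp measurable_snd (measurable_path_coord t)). Qed.

Definition transition t (w : path) : A * W := ((w t).2, (w t.+1).1).

Lemma measurable_transition t : measurable_fun [set: path] (transition t).
Proof.
by apply/measurable_fun_pairP; split;
  [exact: measurable_choice|exact: measurable_state].
Qed.

(** With the trivial history event, [is_path_law] says that the law of [transition t] is the
    [P]-mixture of the laws [Pi (w t).1]; agreement on sets passes to nonnegative functions. *)
Lemma integral_transition b P t (h : A * W -> \bar R) : is_path_law Pi b P ->
  measurable_fun setT h -> (forall p, 0 <= h p) ->
  \int[P]_w h (transition t w) = \int[P]_w \int[Pi (w t).1]_p h p.
Proof.
move=> [_ PS] mh h0.
have mst : measurable_fun setT (fun z : path * path => (z.2 t).1).
  exact: (measurableT_comp (measurable_state t) measurable_snd).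
(* A constant kernel, evaluated at an arbitrary point, presents the mixture as a composition of
   kernels. *)
pose l := kprobability (measurable_cst (P : pprobability _ R)) : path -> _.
pose w0 : path := point.
transitivity (\int[pkcomp l (kcomap Pi mst) w0]_p h p); last first.
  by rewrite integral_pkcomp.
rewrite -(integral_pushprob (probability_setT P) (measurable_transition t))//.
apply: eq_measure_integral => B mB _.
have := PS t setT B _ mB; rewrite setTI; apply.
exact: (@measurableT _ (g_sigma_algebraType _)).
Qed.

Lemma integral_initial_state b P (h : W -> \bar R) : is_path_law Pi b P ->
  measurable_fun setT h -> (forall a, 0 <= h a) ->
  \int[P]_w h (w 0%N).1 = h b.
Proof.
move=> [P0 _] mh h0.
have mb : measurable [set w : path | (w 0%N).1 = b].
  apply: (@history_measurable _ _ _ _ 0).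
  exact: history_state (measurable_worldview1 b).
rewrite -[RHS](probability_integral_cst P); apply: ge0_ae_eq_integral => //.
- exact: measurableT_comp mh (measurable_state 0).
- by apply: filterS (probability1_ae mb P0) => w /= -> _.
Qed.

(** The transition operator of the worldview process. *)
Definition next_mean (h : W -> \bar R) b := \int[Pi b]_p h p.2.

Lemma measurable_next_mean h : measurable_fun setT h -> (forall a, 0 <= h a) ->
  measurable_fun setT (next_mean h).
Proof.
move=> mh h0; apply: measurable_fun_integral_kernel => //.
- exact: measurable_kernel.
- exact: measurableT_comp mh measurable_snd.
Qed.

Lemma next_mean_ge0 h : (forall a, 0 <= h a) -> forall b, 0 <= next_mean h b.
Proof. by move=> h0 b; exact: integral_ge0. Qed.

Lemma iter_next_mean k h : measurable_fun setT h -> (forall a, 0 <= h a) ->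
  measurable_fun setT (iter k next_mean h) /\
  forall a, 0 <= iter k next_mean h a.
Proof.
move=> mh h0; elim: k => [//|k [mk k0]]; split.
  exact: measurable_next_mean.
exact: next_mean_ge0.
Qed.

(** Induction with [h] general: the last transition is absorbed into [h]. *)
Lemma integral_state b P k (h : W -> \bar R) : is_path_law Pi b P ->
  measurable_fun setT h -> (forall a, 0 <= h a) ->
  \int[P]_w h (w k).1 = iter k next_mean h b.
Proof.
move=> bP; elim: k h => [|k IH] h mh h0; first exact: integral_initial_state.
rewrite iterSr -IH; last 2 first.
- exact: measurable_next_mean.
- exact: next_mean_ge0.
exact: (integral_transition k (h := h \o snd) bP
  (measurableT_comp mh measurable_snd) (fun p => h0 p.2)).
Qed.

(** Convertible to [smarg Pi b], but with a probability instance. *)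
Definition smarg_law b : probability A R :=
  pushprob (prob_kernel b : Pi b setT = 1) (@measurable_fst _ _ A W).

Lemma smargE b : smarg Pi b = smarg_law b.
Proof. by []. Qed.

Definition kappa_law b : probability W R :=
  pushprob (prob_kernel b : Pi b setT = 1) (@measurable_snd _ _ A W).

Lemma kappaE b : kappa Pi b = kappa_law b.
Proof. by []. Qed.

Lemma integral_kappa_law b (h : W -> \bar R) :
  measurable_fun setT h -> (forall a, 0 <= h a) ->
  \int[kappa_law b]_a h a = next_mean h b.
Proof. exact: integral_pushprob. Qed.

End one_step.

(** * Discounted payoffs *)

Section payoff_bounds.
Variables (R : realType) (n : nat) (X : finType) (x0 : X).
Variables (u : 'I_n.+1 -> X -> R) (lambda delta : R).
Hypotheses (lambda_ge0 : 0 <= lambda) (lambda_le1 : lambda <= 1)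
  (delta_gt0 : 0 < delta) (delta_lt1 : delta < 1).
Implicit Types (a b : worldview R n) (x : X).

Lemma weight_ge0 a j : 0 <= weight a j.
Proof. by rewrite /weight; case: a => a /= /set_mem[]. Qed.

Lemma weight_sum1 a : \sum_j weight a j = 1.
Proof. by rewrite /weight; case: a => a /= /set_mem[]. Qed.

Lemma weight_le1 a j : weight a j <= 1.
Proof.
rewrite -(weight_sum1 a) (bigD1 j)//= lerDl sumr_ge0// => k _.
exact: weight_ge0.
Qed.

Lemma weight_vertex j k : weight (vertex R j : worldview R n) k = (k == j)%:R.
Proof. by rewrite /weight /= mxE eqxx. Qed.

Lemma U_vertex j x : U u (vertex R j) x = u j x.
Proof.
rewrite /U (bigD1 j)//= weight_vertex eqxx mul1r big1 ?addr0// => k kj.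
by rewrite weight_vertex (negbTE kj) mul0r.
Qed.

(** A crude bound on [U], uniform in worldviews and actions. Adding it to payoffs makes them
    nonnegative, so that series and integrals can be exchanged by monotone convergence. *)
Definition payoff_bound : R := \sum_j \sum_x `|u j x|.

Lemma normr_U_le a x : `|U u a x| <= payoff_bound.
Proof.
apply: le_trans (ler_norm_sum _ _ _) _; apply: ler_sum => j _.
rewrite normrM (ger0_norm (weight_ge0 a j)).
apply: (@le_trans _ _ `|u j x|).
  by rewrite ler_piMl// weight_le1.
by rewrite (bigD1 x)//= lerDl sumr_ge0.
Qed.

Lemma U_ge a x : 0 <= U u a x + payoff_bound.
Proof.
by have := normr_U_le a x; rewrite ler_norml -lerBlDr sub0r => /andP[].
Qed.

Lemma U_le a x : U u a x <= payoff_bound.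
Proof. exact: le_trans (ler_norm _) (normr_U_le a x). Qed.

Lemma payoff_bound_ge0 : 0 <= payoff_bound.
Proof. by do 2 apply: sumr_ge0 => ? _. Qed.

(** Here [a] is the worldview that evaluates and [b] the one held in that period. *)
Definition gain a b x : R := (1 - lambda) * U u b x + lambda * U u a x.

Lemma gain_ge a b x : 0 <= gain a b x + payoff_bound.
Proof.
have -> : gain a b x + payoff_bound = (1 - lambda) * (U u b x + payoff_bound)
    + lambda * (U u a x + payoff_bound) by rewrite /gain; ring.
by rewrite addr_ge0// mulr_ge0// ?subr_ge0// U_ge.
Qed.

Lemma gain_le a b x : gain a b x <= payoff_bound.
Proof.
have -> : payoff_bound = (1 - lambda) * payoff_bound + lambda * payoff_bound.
  by ring.
by rewrite lerD// ler_wpM2l// ?subr_ge0// U_le.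
Qed.

Lemma EFin_limn_series (v : nat -> R) : (forall k, 0 <= v k) ->
  cvgn (series v) -> (\sum_(k <oo) (v k)%:E = (limn (series v))%:E)%E.
Proof.
move=> v0 cv; rewrite -EFin_lim//; congr (limn _).
by apply/funext => N; rewrite /= sumEFin.
Qed.

Lemma payoffE a (w : sample_path R n x0) : (payoff u lambda delta a w)%:E =
  (\sum_(k <oo) (delta ^+ k * (gain a (w k).1 (w k).2 + payoff_bound))%:E -
   (payoff_bound / (1 - delta))%:E)%E.
Proof.
have dn : `|delta| < 1 by rewrite gtr0_norm.
have dk k : 0 <= delta ^+ k by rewrite exprn_ge0 ?ltW.
set v := fun k => delta ^+ k * (gain a (w k).1 (w k).2 + payoff_bound).
have v0 k : 0 <= v k by exact: mulr_ge0 (dk k) (gain_ge _ _ _).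
have cgeo r := @cvg_geometric_series R r delta dn.
have cv : cvgn (series v).
  (* A shifted gain is at most twice [payoff_bound], whence the dominating geometric series. *)
  apply: (@series_le_cvg _ _ (geometric (payoff_bound *+ 2) delta)) => //.
  - by move=> k; rewrite /= mulr_ge0 ?dk// mulrn_wge0 ?payoff_bound_ge0.
  - move=> k; rewrite /v /= mulrC ler_wpM2r// mulr2n.
    by rewrite lerD2r gain_le.
  - exact: cvgP (cgeo _).
rewrite EFin_limn_series// -EFinB /payoff; congr (_%:E).
rewrite -(cvg_lim _ (cgeo payoff_bound))//.
rewrite -lim_seriesB//; last exact: cvgP (cgeo _).
congr (limn (series _)); apply/funext => k.
rewrite !fctE /v /gain /=; ring.
Qed.

Lemma geometric_nneseries (c : R) : 0 <= c ->
  (\sum_(k <oo) (c * delta ^+ k)%:E = (c / (1 - delta))%:E)%E.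
Proof.
move=> c0; have cgeo := @cvg_geometric_series R c delta.
rewrite EFin_limn_series; last 2 first.
- by move=> k; rewrite mulr_ge0// exprn_ge0// ltW.
- by apply: cvgP; apply: cgeo; rewrite gtr0_norm.
by congr (_%:E); apply: cvg_lim => //; apply: cgeo; rewrite gtr0_norm.
Qed.

(** The default value is itself one of the compared utilities, so this is the true maximum. *)
Definition U_max a : R := \big[Num.max/U u a x0]_x U u a x.

Lemma zstar_nonempty a : exists x, x \in zstar u a.
Proof.
have [x _ xmax] := @arg_maxP _ _ _ x0 xpredT (U u a) isT.
by exists x; rewrite inE; apply/forallP => y; exact: xmax.
Qed.

Lemma zstar_U_max a x : x \in zstar u a -> U u a x = U_max a.
Proof.
rewrite inE => /forallP xz; apply/eqP; rewrite eq_le; apply/andP; split.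
  exact: le_bigmax.
by apply/bigmax_leP; split => // [|y _]; exact: xz.
Qed.

Lemma U_max_ge a : 0 <= U_max a + payoff_bound.
Proof.
apply: le_trans (U_ge a x0) _; rewrite lerD2r; exact: le_bigmax.
Qed.

Lemma measurable_U x : measurable_fun [set: worldview R n] (fun a => U u a x).
Proof.
apply: measurable_sum => j; apply: measurable_funM => //.
exact: measurable_weight.
Qed.

Lemma measurable_U_max : measurable_fun [set: worldview R n] U_max.
Proof.
rewrite /U_max; elim: (index_enum X) => [|x s IH].
  under eq_fun do rewrite big_nil.
  exact: measurable_U.
under eq_fun do rewrite big_cons.
by apply: measurable_maxr => //; exact: measurable_U.
Qed.

Lemma measurable_action d (T : measurableType d) (f : action x0 -> T) :
  measurable_fun [set: action x0] f.
Proof. by []. Qed.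

Lemma measurable_gain a : measurable_fun setT
  (fun p : worldview R n * action x0 => gain a p.1 p.2).
Proof.
apply: measurable_funD; apply: measurable_funM => //.
  apply: measurable_sum => j; apply: measurable_funM.
    exact: measurableT_comp (measurable_weight j) measurable_fst.
  exact: measurableT_comp (measurable_action (u j)) measurable_snd.
exact: measurableT_comp (measurable_action (U u a)) measurable_snd.
Qed.

Lemma measurable_zstar x : measurable [set a : worldview R n | x \in zstar u a].
Proof.
rewrite (_ : [set a | _] =
    \bigcap_(y in [set: X]) [set a | U u a y <= U u a x]).
  apply: fin_bigcap_measurable => // y _.
  have mle := measurable_fun_ler (measurable_U y) (measurable_U x).
  by have := mle measurableT [set true] Logic.I; rewrite setTI.
apply/seteqP; split => a; rewrite /= inE.
  by move=> /forallP xz y _; exact: xz.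
by move=> xz; apply/forallP => y; exact: xz.
Qed.

End payoff_bounds.

(** * Values as discounted series of mean rewards *)

Section values.
Variables (R : realType) (n : nat) (X : finType) (x0 : X).
Variables (u : 'I_n.+1 -> X -> R) (lambda delta : R) (Pi : strategy R n x0).
Hypotheses (lambda_ge0 : 0 <= lambda) (lambda_le1 : lambda <= 1)
  (delta_gt0 : 0 < delta) (delta_lt1 : delta < 1).
Hypothesis optimal : forall a, smarg Pi a [set` zstar u a] = 1%E.
Implicit Types (a b : worldview R n) (x : X).
Implicit Types (P : probability (sample_path R n x0) R).
Local Notation path := (sample_path R n x0).
Local Notation M := (payoff_bound u).
Local Open Scope ereal_scope.

Lemma measurable_chosen (B : set (action x0)) :
  measurable [set p : action x0 * worldview R n | B p.1].
Proof. by rewrite -[X in measurable X]setTI; exact: measurable_fst. Qed.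

Lemma suboptimal_null a x : x \notin zstar u a ->
  Pi a [set p | p.1 = x] = 0.
Proof.
move=> xz; rewrite -[LHS]/(smarg_law Pi a [set x]).
apply/eqP; rewrite -measure_le0.
have <- : smarg_law Pi a (~` [set` zstar u a]) = 0.
  by rewrite probability_setC// -smargE optimal subee.
apply: le_measure; rewrite ?inE//.
by move=> y -> /=; apply/negP.
Qed.

(** As [X] is finite, one action [x] can be treated at a time: on the history event where [x] is
    suboptimal, the kernel gives the choice of [x] mass 0. *)
Lemma ae_zstar b P t : is_path_law Pi b P ->
  {ae P, forall w, (w t).2 \in zstar u (w t).1}.
Proof.
move=> [_ PS].
have aex x : {ae P, forall w, (w t).2 = x -> x \in zstar u (w t).1}.
  have mA : measurable [set a | x \notin zstar u a].
    rewrite (_ : [set a | _] = ~` [set a | x \in zstar u a]).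
      by apply: measurableC; exact: measurable_zstar.
    by apply/seteqP; split => a /= /negP.
  have hA := @history_state R n X x0 t _ mA.
  have mB := measurable_chosen [set x].
  exists ([set w | x \notin zstar u (w t).1] `&`
          [set w | [set p | p.1 = x] ((w t).2, (w t.+1).1)]); split.
  - apply: measurableI; first exact: history_measurable hA.
    have := measurable_transition t measurableT mB.
    by rewrite setTI.
  - rewrite [LHS](PS t _ _ hA mB) integral0_eq// => w /= wx.
    exact: suboptimal_null.
  - move=> w /= /not_implyP[wx /negP nz]; split => //.
by apply: filterS (filter_forall _ aex) => w; exact.
Qed.

(* Since [x_t] is optimal for [alpha_t], the realized part of the gain depends
   on [alpha_t] only, so that marginal laws determine the expected gain.
   Payoffs are shifted by [M] to be nonnegative. *)
Definition reward a b : \bar R :=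
  (((1 - lambda) * (U_max x0 u b + M))%R)%:E +
  \int[Pi b]_p ((lambda * (U u a p.1 + M))%R)%:E.

Let ge0_persuasion a x : (0 <= lambda * (U u a x + M))%R.
Proof. by rewrite mulr_ge0// U_ge. Qed.

Let ge0_realized b : (0 <= (1 - lambda) * (U_max x0 u b + M))%R.
Proof. by rewrite mulr_ge0// ?subr_ge0// U_max_ge. Qed.

Let measurable_realized : measurable_fun setT
  (fun b => ((1 - lambda) * (U_max x0 u b + M))%R%:E).
Proof.
apply/measurable_EFinP; apply: measurable_funM => //.
by apply: measurable_funD => //; exact: measurable_U_max.
Qed.

Let measurable_persuasion a : measurable_fun setT
  (fun p : action x0 * worldview R n => (lambda * (U u a p.1 + M))%R%:E).
Proof.
exact: (measurableT_comp (measurable_action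
  (fun x : action x0 => (lambda * (U u a x + M))%R%:E)) measurable_fst).
Qed.

Let measurable_mean_persuasion a : measurable_fun setT
  (fun b => \int[Pi b]_p (lambda * (U u a p.1 + M))%R%:E).
Proof.
apply: measurable_fun_integral_kernel => //; first exact: measurable_kernel.
by move=> p; rewrite lee_fin.
Qed.

Lemma reward_ge0 a b : 0 <= reward a b.
Proof.
apply: adde_ge0; rewrite ?lee_fin//.
by apply: integral_ge0 => p _; rewrite lee_fin.
Qed.

Lemma measurable_reward a : measurable_fun setT (reward a).
Proof. exact: emeasurable_funD. Qed.

Lemma measurable_shifted_gain a k : measurable_fun [set: path]
  (fun w => (gain u lambda a (w k).1 (w k).2 + M)%R%:E).
Proof.
apply/measurable_EFinP; apply: measurable_funD => //.
exact: (measurableT_comp (measurable_gain u lambda a)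
  (measurable_path_coord k)).
Qed.

(** Almost-sure optimality turns the realized part into a function of the state through [U_max]; the
    part evaluated at [a] is averaged through one transition. *)
Lemma mean_gain b P a k : is_path_law Pi b P ->
  \int[P]_w (gain u lambda a (w k).1 (w k).2 + M)%R%:E =
  iter k (next_mean Pi) (reward a) b.
Proof.
move=> bP.
rewrite -(integral_state k bP (measurable_reward a) (reward_ge0 a)).
transitivity (\int[P]_w (((1 - lambda) * (U_max x0 u (w k).1 + M))%R%:E +
    (lambda * (U u a (w k).2 + M))%R%:E)).
  apply: ge0_ae_eq_integral => //.
  - exact: measurable_shifted_gain.
  - apply: emeasurable_funD.
      exact: measurableT_comp measurable_realized (measurable_state k).
    exact: (measurableT_comp (measurable_persuasion a)
      (measurable_transition k)).
  - by move=> w _; rewrite lee_fin gain_ge.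
  - by move=> w _; rewrite adde_ge0// lee_fin.
  - have FP : Filter (almost_everywhere P) := ae_filter_ringOfSetsType P.
    move: (ae_zstar k bP); apply: filterS => w wz _.
    by rewrite /gain (zstar_U_max x0 wz) -EFinD; congr (_%:E); ring.
rewrite ge0_integralD//; last 4 first.
- by move=> w _; rewrite lee_fin.
- exact: measurableT_comp measurable_realized (measurable_state k).
- by move=> w _; rewrite lee_fin.
- exact: (measurableT_comp (measurable_persuasion a) (measurable_transition k)).
rewrite [RHS]ge0_integralD//; last 4 first.
- by move=> w _; rewrite lee_fin.
- exact: measurableT_comp measurable_realized (measurable_state k).
- by move=> w _; apply: integral_ge0 => p _; rewrite lee_fin.
- exact: measurableT_comp (measurable_mean_persuasion a) (measurable_state k).
congr (_ + _).
apply: (integral_transition k bP (measurable_persuasion a)).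
by move=> p; rewrite lee_fin.
Qed.

(** The payoff [Cval] shifted by [M / (1 - delta)] (see [CvalE]). As a series in the transition
    operator it is measurable in [b], which is not apparent for an expectation under [path_law]. *)
Definition value a b : \bar R :=
  \sum_(k <oo) (delta ^+ k)%:E * iter k (next_mean Pi) (reward a) b.

Let discount_ge0 k : (0 <= delta ^+ k)%R.
Proof. by rewrite exprn_ge0// ltW. Qed.

Let measurable_iter k a :
  measurable_fun setT (iter k (next_mean Pi) (reward a)).
Proof.
by have [] := iter_next_mean Pi k (measurable_reward a) (reward_ge0 a).
Qed.

Let iter_ge0 k a b : 0 <= iter k (next_mean Pi) (reward a) b.
Proof.
by have [] := iter_next_mean Pi k (measurable_reward a) (reward_ge0 a).
Qed.

Lemma value_term_ge0 k a b :
  0 <= (delta ^+ k)%:E * iter k (next_mean Pi) (reward a) b.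
Proof. by rewrite mule_ge0// lee_fin. Qed.

Lemma measurable_value a : measurable_fun setT (value a).
Proof.
apply: ge0_emeasurable_sum => [k b _ _|k _]; first exact: value_term_ge0.
exact: measurable_funeM.
Qed.

Lemma value_ge0 a b : 0 <= value a b.
Proof. by apply: nneseries_ge0 => k _ _; exact: value_term_ge0. Qed.

(** The first term of the series is split off, and one application of the operator and one factor
    [delta] are taken out of the rest. *)
Lemma value_bellman a b :
  value a b = reward a b + delta%:E * \int[kappa_law Pi b]_c value a c.
Proof.
rewrite integral_kappa_law; [|exact: measurable_value|exact: value_ge0].
rewrite {1}/value nneseries_recl//; last by move=> k _; exact: value_term_ge0.
rewrite expr0 mul1e; congr (_ + _).
rewrite -nneseries_addn; last by move=> k; exact: value_term_ge0.
rewrite /next_mean /value integral_nneseries//; last 2 first.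
- move=> k; apply: measurable_funeM.
  exact: measurableT_comp (measurable_iter k a) measurable_snd.
- by move=> k p _; exact: value_term_ge0.
rewrite -nneseriesZl; last first.
  by move=> k _; apply: integral_ge0 => p _; exact: value_term_ge0.
apply: eq_eseriesr => k _; rewrite addn1 exprS EFinM -muleA; congr (_ * _).
rewrite ge0_integralZl//.
- exact: measurableT_comp (measurable_iter k a) measurable_snd.
- by rewrite lee_fin.
Qed.

Lemma CvalE b a :
  Cval u lambda delta Pi b a = value a b - (M / (1 - delta))%:E.
Proof.
have bP := path_lawP Pi b.
have term_ge0 k (w : path) :
    0 <= (delta ^+ k * (gain u lambda a (w k).1 (w k).2 + M))%R%:E.
  by rewrite lee_fin mulr_ge0// gain_ge.
have mterm k : measurable_fun [set: path]
    (fun w => (delta ^+ k * (gain u lambda a (w k).1 (w k).2 + M))%R%:E).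
  under eq_fun do rewrite EFinM.
  by apply: measurable_funeM; exact: measurable_shifted_gain.
rewrite /Cval unlock.
under eq_integral do rewrite payoffE//.
(* The bound sums the discounted shifted gains, each at most [M + M]. *)
rewrite (@integral_subr_cst _ _ _ _ _ ((M + M) / (1 - delta))).
- rewrite integral_nneseries//; congr (_ - _); apply: eq_eseriesr => k _.
  rewrite -(mean_gain _ _ bP).
  under eq_integral do rewrite EFinM.
  rewrite ge0_integralZl//; first exact: measurable_shifted_gain.
  + by move=> w _; rewrite lee_fin gain_ge.
  + by rewrite lee_fin.
- by apply: ge0_emeasurable_sum => // k w _ _; exact: term_ge0.
- move=> w; rewrite nneseries_ge0//=.
  apply: (@le_trans _ _ (\sum_(k <oo) ((M + M) * delta ^+ k)%R%:E)).
    apply: lee_nneseries => // k _; rewrite lee_fin mulrC ler_wpM2r//.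
    by rewrite lerD2r gain_le.
  rewrite geometric_nneseries//.
  by rewrite addr_ge0// payoff_bound_ge0.
Qed.

Lemma value_le_geometric a b (c : R) : (0 <= c)%R ->
  (forall k, iter k (next_mean Pi) (reward a) b <= c%:E) ->
  value a b <= (c / (1 - delta))%:E.
Proof.
move=> c0 rc; rewrite -geometric_nneseries//; apply: lee_nneseries.
  by move=> k _ _; exact: value_term_ge0.
by move=> k _; rewrite [(c * _)%R]mulrC EFinM lee_wpmul2l// lee_fin.
Qed.

Lemma mean_gain_le b P a k (c : R) : is_path_law Pi b P -> (0 <= c + M)%R ->
  {ae P, forall w, (gain u lambda a (w k).1 (w k).2 <= c)%R} ->
  iter k (next_mean Pi) (reward a) b <= (c + M)%:E.
Proof.
move=> bP cM gc.
rewrite -(mean_gain _ _ bP) -(probability_integral_cst P (c + M)%:E).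
apply: ae_ge0_le_integral => //.
- by move=> w _; rewrite lee_fin gain_ge.
- exact: measurable_shifted_gain.
- have FP : Filter (almost_everywhere P) := ae_filter_ringOfSetsType P.
  by move: gc; apply: filterS => w gw _; rewrite lee_fin lerD2r.
Qed.

Lemma value_le a b (c : R) :
  (forall b' x, x \in zstar u b' -> (gain u lambda a b' x <= c)%R) ->
  value a b <= ((c + M) / (1 - delta))%:E.
Proof.
move=> gc; have bP := path_lawP Pi b.
(* Some action is optimal at [b], and its shifted gain is nonnegative. *)
have cM : (0 <= c + M)%R.
  have [x xz] := zstar_nonempty x0 u b.
  by rewrite (le_trans (gain_ge u lambda_ge0 lambda_le1 a b x))// lerD2r gc.
apply: value_le_geometric => // k; apply: (mean_gain_le bP cM).
have FP : Filter (almost_everywhere (path_law Pi b)) :=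
  ae_filter_ringOfSetsType _.
by move: (ae_zstar k bP); apply: filterS => w wz; exact: gc.
Qed.

(** The reward is the mean shifted gain at time 0, when the state is almost surely [b]; hence only
    actions optimal at [b] matter. *)
Lemma reward_le a b (c : R) :
  (forall x, x \in zstar u b -> (gain u lambda a b x <= c)%R) ->
  reward a b <= (c + M)%:E.
Proof.
move=> gc; have bP := path_lawP Pi b.
have cM : (0 <= c + M)%R.
  have [x xz] := zstar_nonempty x0 u b.
  by rewrite (le_trans (gain_ge u lambda_ge0 lambda_le1 a b x))// lerD2r gc.
apply: (mean_gain_le (k := 0) bP cM).
have mb : measurable [set w : path | (w 0%N).1 = b].
  apply: (@history_measurable _ _ _ _ 0).
  exact: history_state (measurable_worldview1 b).
have FP : Filter (almost_everywhere (path_law Pi b)) :=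
  ae_filter_ringOfSetsType _.
move: (ae_zstar 0 bP) (probability1_ae mb bP.1); apply: filterS2 => w wz /= wb.
by rewrite wb gc// -wb.
Qed.

Lemma reward_eq a b (c : R) :
  (forall x, x \in zstar u b -> gain u lambda a b x = c) ->
  reward a b = (c + M)%:E.
Proof.
move=> gc; have bP := path_lawP Pi b.
have cM : (0 <= c + M)%R.
  have [x xz] := zstar_nonempty x0 u b.
  by rewrite -(gc x)// gain_ge.
rewrite -[reward a b](mean_gain a 0 bP).
rewrite -[RHS](probability_integral_cst (path_law Pi b)).
have mb : measurable [set w : path | (w 0%N).1 = b].
  apply: (@history_measurable _ _ _ _ 0).
  exact: history_state (measurable_worldview1 b).
apply: ge0_ae_eq_integral => //.
- exact: measurable_shifted_gain.
- by move=> w _; rewrite lee_fin gain_ge.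
- have FP : Filter (almost_everywhere (path_law Pi b)) :=
    ae_filter_ringOfSetsType _.
  move: (ae_zstar 0 bP) (probability1_ae mb bP.1).
  by apply: filterS2 => w wz /= wb _; rewrite wb gc// -wb.
Qed.

Lemma value_bounds a b : 0 <= value a b <= ((M + M) / (1 - delta))%:E.
Proof.
rewrite value_ge0 value_le// => b' x _; exact: gain_le.
Qed.

Lemma SvalE a : Sval u lambda delta Pi a =
  \int[kappa_law Pi a]_b value a b - (M / (1 - delta))%:E.
Proof.
rewrite /Sval kappaE.
rewrite -(integral_subr_cst _ _ (measurable_value a) (value_bounds a)).
by apply: eq_integral => b _; rewrite CvalE.
Qed.

End values.

(** * Equilibria *)

Section tailored.
Variables (R : realType) (n : nat) (X : finType).
Variables (u : 'I_n.+1 -> X -> R) (i : X -> 'I_n.+1) (lambda : R).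
Hypotheses (tailored : strictly_tailored u i)
  (lambda_gt : lambda_star u i < lambda) (lambda_lt1 : lambda < 1).
Implicit Types (a b : worldview R n) (x y : X).

Lemma zstar_XI a x : x \in zstar u a -> x \in XI u.
Proof. by move=> xz; rewrite inE; apply/asboolP; exists a. Qed.

Lemma lambda_star_ge0 : 0 <= lambda_star u i.
Proof. exact: bigmax_ge_id. Qed.

Lemma lambda_gt0 : 0 < lambda.
Proof. exact: le_lt_trans lambda_star_ge0 lambda_gt. Qed.

Lemma u_le_tailored x j : x \in XI u -> u j x <= u (i x) x.
Proof.
move=> /tailored[_ ux]; have [->//|/ux/ltW//] := eqVneq j (i x).
Qed.

Lemma U_le_tailored b x : x \in XI u -> U u b x <= u (i x) x.
Proof.
move=> xI; rewrite -[leRHS]mul1r -(weight_sum1 b) mulr_suml.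
by apply: ler_sum => j _; rewrite ler_wpM2l ?weight_ge0 ?u_le_tailored.
Qed.

(** Among the numbers [u j x], the one at [i x] is strictly largest, so any weight put elsewhere
    lowers the average strictly. *)
Lemma U_eq_tailored b x :
  x \in XI u -> u (i x) x <= U u b x -> b = alphaI R i x.
Proof.
move=> xI uU.
have w0 j : j != i x -> weight b j = 0.
  move=> ji; have [_ ux] := tailored xI.
  have : 0 <= weight b j by exact: weight_ge0.
  rewrite le_eqVlt => /predU1P[<-//|wj].
  suff : U u b x < u (i x) x by rewrite ltNge uU.
  rewrite -[ltRHS]mul1r -(weight_sum1 b) mulr_suml /U.
  rewrite (bigD1 j)//= [ltRHS](bigD1 j)//=; apply: ltr_leD.
    by rewrite ltr_pM2l// ux.
  by apply: ler_sum => k _; rewrite ler_wpM2l ?weight_ge0 ?u_le_tailored.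
apply: worldview_eqP => j; rewrite weight_vertex.
have [->|/w0//] := eqVneq j (i x).
by rewrite -[RHS](weight_sum1 b) (bigD1 (i x))//= big1 ?addr0.
Qed.

Lemma gain_le_gval a b x :
  x \in XI u -> gain u lambda a b x <= gval u i lambda x a.
Proof.
move=> xI; rewrite /gain /gval lerD2r ler_wpM2l ?U_le_tailored//.
by rewrite subr_ge0 ltW.
Qed.

Lemma gain_eq_gval a b x : x \in XI u ->
  gval u i lambda x a <= gain u lambda a b x -> b = alphaI R i x.
Proof.
move=> xI; rewrite /gain /gval lerD2r ler_pM2l ?subr_gt0//.
exact: U_eq_tailored.
Qed.

Lemma gain_alphaI a x : gain u lambda a (alphaI R i x) x = gval u i lambda x a.
Proof. by rewrite /gain /gval U_vertex. Qed.

Lemma zstar_alphaI x y : x \in XI u -> y \in zstar u (alphaI R i x) -> y = x.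
Proof.
move=> xI; rewrite inE => /forallP/(_ x); rewrite !U_vertex => uxy.
apply/eqP; apply: contraTT uxy => yx; rewrite -ltNge.
by have [->] := tailored xI.
Qed.

Lemma GammaP a x : reflect
  (x \in XI u /\
   forall y, y \in XI u -> gval u i lambda y a <= gval u i lambda x a)
  (x \in Gamma u i lambda a).
Proof.
rewrite /Gamma finset.in_set; apply: (iffP andP) => -[xI xmax]; split => //.
  by move=> y yI; move/forallP: xmax => /(_ y) /implyP; exact.
by apply/forallP => y; apply/implyP; exact: xmax.
Qed.

Lemma Gamma_XI a x : x \in Gamma u i lambda a -> x \in XI u.
Proof. by move=> /GammaP[]. Qed.

Lemma Gval_Gamma a x : x \in Gamma u i lambda a ->
  Gval u i lambda a = gval u i lambda x a.
Proof.
move=> /GammaP[xI xmax]; apply/eqP; rewrite eq_le; apply/andP; split.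
  apply: ge_sup; first by exists (gval u i lambda x a), x.
  by move=> _ [y yI <-]; exact: xmax.
apply: ub_le_sup; last by exists x.
by exists (gval u i lambda x a) => _ [y yI <-]; exact: xmax.
Qed.

Lemma Gamma_nonempty (x0 : X) a : exists x, x \in Gamma u i lambda a.
Proof.
have [x1 x1z] := zstar_nonempty x0 u a.
have [x xI xmax] := @arg_maxP _ _ _ x1 (mem (XI u))
  (fun x => gval u i lambda x a) (zstar_XI x1z).
by exists x; apply/GammaP; split.
Qed.

Lemma gval_le_Gval (x0 : X) a x : x \in XI u ->
  gval u i lambda x a <= Gval u i lambda a.
Proof.
have [y yG] := Gamma_nonempty x0 a; rewrite (Gval_Gamma yG).
by have /GammaP[_] := yG; exact.
Qed.

Lemma Gamma_gval a x : x \in XI u ->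
  Gval u i lambda a <= gval u i lambda x a -> x \in Gamma u i lambda a.
Proof.
move=> xI Gx; apply/GammaP; split => // y yI.
exact: le_trans (gval_le_Gval x a yI) Gx.
Qed.

(** If [i x = i y], each of [x] and [y] would strictly beat the other at the same pure worldview. So
    the indices differ, and the second half of tailoring applies to [y]. *)
Lemma Rgap_gt0 x y : x \in XI u -> y \in XI u -> y != x -> 0 < Rgap u i x y.
Proof.
move=> xI yI yx; rewrite subr_gt0.
have [ux _] := tailored xI; have [uy uyj] := tailored yI.
apply: uyj; apply/eqP => ixy.
have := ux _ yx; rewrite ixy => uyx.
by have := uy x; rewrite eq_sym yx => /(_ isT)/(lt_trans uyx); rewrite ltxx.
Qed.

(* [lambda_star] is exactly the threshold above which staying at the own pure
   worldview of [x] beats any other destination there. *)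
Lemma Gamma_alphaI x y : x \in XI u ->
  y \in Gamma u i lambda (alphaI R i x) -> y = x.
Proof.
move=> xI /GammaP[yI /(_ x xI) gxy]; apply/eqP; apply: contraTT gxy => yx.
rewrite -ltNge /gval !U_vertex.
have R0 := Rgap_gt0 xI yI yx.
have : 1 - Dgap u i x y / Rgap u i x y < lambda.
  apply: le_lt_trans lambda_gt; rewrite /lambda_star.
  apply: le_trans (le_bigmax_cond _ _ xI).
  by apply: (le_bigmax_cond _ _ (j := y)); rewrite yI.
rewrite ltrBlDr -ltrBlDl ltr_pdivlMr// /Rgap /Dgap => lt_DR.
(* At [alphaI x] the two values differ by [Dgap - (1 - lambda) * Rgap], which the threshold makes
   positive. *)
rewrite -subr_gt0.
have -> : (1 - lambda) * u (i x) x + lambda * u (i x) x -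
    ((1 - lambda) * u (i y) y + lambda * u (i x) y) =
  (u (i x) x - u (i x) y) - (1 - lambda) * (u (i y) y - u (i x) y) by ring.
by rewrite subr_gt0.
Qed.

End tailored.

Section transitions.
Variables (R : realType) (n : nat) (X : finType) (x0 : X).
Variable Pi : strategy R n x0.
Implicit Types (b : worldview R n) (P : probability (sample_path R n x0) R).

(** The exceptional event, in [E] at [t] and outside [B] at [t+1], is null because the kernel gives
    the complement of [B] mass 0 from every state in [E]. *)
Lemma ae_next b P t (E B : set (worldview R n)) : is_path_law Pi b P ->
  measurable E -> measurable B -> (forall a, E a -> kappa Pi a B = 1%E) ->
  {ae P, forall w, E (w t).1 -> B (w t.+1).1}.
Proof.
move=> [_ PS] mE mB EB.
have hE := @history_state R n X x0 t _ mE.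
have mCB : measurable (~` B) by exact: measurableC.
have mN := @measurable_next_worldview R n X x0 _ mCB.
exists ([set w | E (w t).1] `&`
        [set w | [set p | (~` B) p.2] ((w t).2, (w t.+1).1)]); split.
- apply: measurableI; first exact: history_measurable hE.
  have := measurable_transition t measurableT mN.
  by rewrite setTI.
- rewrite [LHS](PS t _ _ hE mN) integral0_eq// => w /= Ew.
  rewrite -[LHS]/(kappa_law Pi (w t).1 (~` B)).
  by rewrite probability_setC// -kappaE EB// subee.
- by move=> w /= /not_implyP[Ew nB].
Qed.

End transitions.

(** * Equilibria and their pure destinations *)

Section equilibrium.
Variables (R : realType) (n : nat) (X : finType) (x0 : X).
Variables (u : 'I_n.+1 -> X -> R) (i : X -> 'I_n.+1) (lambda delta : R).
Variable Pi : strategy R n x0.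
Hypotheses (tailored : strictly_tailored u i)
  (lambda_gt : lambda_star u i < lambda) (lambda_lt1 : lambda < 1)
  (delta_gt0 : 0 < delta) (delta_lt1 : delta < 1).
Implicit Types (a b : worldview R n) (x : X).

Let lambda_ge0 : 0 <= lambda.
Proof. exact: ltW (lambda_gt0 lambda_gt). Qed.

Let lambda_le1 : lambda <= 1.
Proof. exact: ltW. Qed.

Let delta1_gt0 : 0 < 1 - delta.
Proof. by rewrite subr_gt0. Qed.

Local Notation M := (payoff_bound u).
Local Notation value := (value u lambda delta Pi).
Local Notation reward := (reward u lambda Pi).
Local Notation Gamma := (Gamma u i lambda).
Local Notation Gval := (Gval u i lambda).
Local Notation gval := (gval u i lambda).
Local Notation destinations a := (alphaI R i @` [set` Gamma a]).

Lemma measurable_destinations a : measurable (destinations a).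
Proof. exact: measurable_image_fintype. Qed.

Section optimal_actions.
Hypothesis optimal : forall a, smarg Pi a [set` zstar u a] = 1%E.

Let measurable_value a : measurable_fun setT (value a).
Proof. exact: measurable_value. Qed.

Lemma value_le_Gval a b : (value a b <= ((Gval a + M) / (1 - delta))%:E)%E.
Proof.
apply: value_le => // b' x /zstar_XI xI.
apply: le_trans (gain_le_gval tailored lambda_lt1 a b' xI) _.
exact: gval_le_Gval.
Qed.

Lemma mean_value_le_Gval a b :
  (\int[kappa_law Pi b]_c value a c <= ((Gval a + M) / (1 - delta))%:E)%E.
Proof.
rewrite -(probability_integral_cst (kappa_law Pi b)
  ((Gval a + M) / (1 - delta))%:E).
apply: ge0_le_integral => //.
- by move=> c _; exact: value_ge0.
- by move=> c _; exact: value_le_Gval.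
Qed.

(* Falling short of [Gval a] in the first period cannot be made up later. *)
Lemma value_max_destination a b :
  (((Gval a + M) / (1 - delta))%:E <= value a b)%E -> destinations a b.
Proof.
move=> Gv; apply: contrapT => ndest.
have gain_lt x : x \in zstar u b -> gain u lambda a b x < Gval a.
  move=> xz; have xI := zstar_XI xz.
  have gg := gain_le_gval tailored lambda_lt1 a b xI.
  have gG := gval_le_Gval i lambda x0 a xI.
  rewrite ltNge; apply/negP => Gg; apply: ndest; exists x.
    exact: (Gamma_gval xI (le_trans Gg gg)).
  by apply/esym/(gain_eq_gval tailored lambda_lt1 xI (le_trans gG Gg)).
(* The best of the finitely many optimal actions gives one bound on the reward that is still
   strictly below [Gval a + M]. *)
have [x1 x1z] := zstar_nonempty x0 u b.
have [x xz xmax] :=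
  @arg_maxP _ _ _ x1 (mem (zstar u b)) (gain u lambda a b) x1z.
have rx : (reward a b <= (gain u lambda a b x + M)%:E)%E.
  by apply: reward_le => // y; exact: xmax.
move: Gv; apply/negP; rewrite -ltNge.
rewrite (value_bellman u Pi lambda_ge0 lambda_le1 delta_gt0 a b).
have dv : (delta%:E * \int[kappa_law Pi b]_c value a c <=
    (delta * ((Gval a + M) / (1 - delta)))%:E)%E.
  rewrite EFinM lee_pmul2l ?lte_fin//; exact: mean_value_le_Gval.
apply: le_lt_trans (leeD rx dv) _; rewrite -EFinD lte_fin.
have d0 : 1 - delta != 0 by rewrite gt_eqF.
(* The bound is the fixed point of [v = Gval a + M + delta * v]. *)
rewrite [ltRHS](_ : _ = Gval a + M + delta * ((Gval a + M) / (1 - delta))).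
  by rewrite ltrD2r ltrD2r gain_lt.
by field.
Qed.

Lemma reward_alphaI a x : x \in XI u ->
  reward a (alphaI R i x) = (gval x a + M)%:E.
Proof.
move=> xI; apply: reward_eq => // y yz.
by rewrite (zstar_alphaI tailored xI yz) gain_alphaI.
Qed.

(** At an absorbing state the Bellman equation reads [v = r + delta * v]; finiteness of [v] allows
    solving it. *)
Lemma value_absorbing a x : x \in XI u ->
  kappa Pi (alphaI R i x) [set alphaI R i x] = 1%E ->
  value a (alphaI R i x) = ((gval x a + M) / (1 - delta))%:E.
Proof.
move=> xI; set e := alphaI R i x => stay.
have vfin : value a e \is a fin_num.
  have /andP[v0 vK] := value_bounds lambda_ge0 lambda_le1 delta_gt0 delta_lt1
    optimal a e.
  by rewrite ge0_fin_numE// (le_lt_trans vK)// ltry.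
have vI : (\int[kappa_law Pi e]_c value a c = value a e)%E.
  rewrite -[RHS](probability_integral_cst (kappa_law Pi e)).
  apply: ge0_ae_eq_integral => //.
  - by move=> c _; exact: value_ge0.
  - by move=> c _; exact: value_ge0.
  - have FP : Filter (almost_everywhere (kappa_law Pi e)) :=
      ae_filter_ringOfSetsType _.
    have me := measurable_worldview1 e.
    move: (probability1_ae (P := kappa_law Pi e) me stay).
    by apply: filterS => c /= -> _.
have := value_bellman u Pi lambda_ge0 lambda_le1 delta_gt0 a e.
rewrite vI reward_alphaI// -(fineK vfin) -EFinM -EFinD => -[] ve.
congr (_%:E); apply: (canRL (mulfK _)); first by rewrite gt_eqF.
by rewrite mulrBr mulr1 {1}ve mulrC addrK.
Qed.

(** A mean equal to the upper bound forces almost every next worldview to attain it, and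
    [value_max_destination] identifies those. *)
Lemma mean_value_max a b :
  (((Gval a + M) / (1 - delta))%:E <= \int[kappa_law Pi b]_c value a c)%E ->
  kappa Pi b (destinations a) = 1%E.
Proof.
move=> GI; rewrite kappaE.
apply: ae_probability1; first exact: measurable_destinations.
have FP : Filter (almost_everywhere (kappa_law Pi b)) :=
  ae_filter_ringOfSetsType _.
have vb c : (0 <= value a c <= ((Gval a + M) / (1 - delta))%:E)%E.
  by rewrite value_ge0// value_le_Gval.
have := ae_eq_bound (measurable_value a) vb GI.
by apply: filterS => c vc; apply: value_max_destination; rewrite vc.
Qed.

(** By [Gamma_alphaI] the only destination from [alphaI x] is itself. *)
Lemma alphaI_absorbing x : x \in XI u ->
  kappa Pi (alphaI R i x) (destinations (alphaI R i x)) = 1%E ->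
  kappa Pi (alphaI R i x) [set alphaI R i x] = 1%E.
Proof.
move=> xI dest; rewrite -[RHS]dest; congr (kappa _ _ _).
have [y yG] := Gamma_nonempty u i lambda x0 (alphaI R i x).
apply/seteqP; split => [_ ->|_ [z zG <-]].
  by exists y => //; rewrite (Gamma_alphaI tailored lambda_gt xI yG).
by rewrite (Gamma_alphaI tailored lambda_gt xI zG).
Qed.

End optimal_actions.

Lemma MPE_destinations : is_MPE u lambda delta Pi -> forall a,
  smarg Pi a [set` zstar u a] = 1%E /\ kappa Pi a (destinations a) = 1%E.
Proof.
move=> mpe.
have optimal a : smarg Pi a [set` zstar u a] = 1%E by have [] := mpe a.
have mean_ge a c : (value a c <= \int[kappa_law Pi a]_b value a b)%E.
  have [_ /(_ c)] := mpe a; rewrite SvalE// CvalE//.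
  by rewrite leeBlDr// subeK.
have absorbing x : x \in XI u ->
    kappa Pi (alphaI R i x) [set alphaI R i x] = 1%E.
  move=> xI; apply: (alphaI_absorbing xI); apply: (mean_value_max optimal).
  set e := alphaI R i x.
  have [y yG] := Gamma_nonempty u i lambda x0 e.
  have yx := Gamma_alphaI tailored lambda_gt xI yG.
  (* Compared with [e] itself, the mean continuation value [I] satisfies
     [I >= Gval e + M + delta * I], so it reaches its upper bound. *)
  have := mean_ge e e.
  rewrite {1}(value_bellman u Pi lambda_ge0 lambda_le1 delta_gt0).
  rewrite (reward_alphaI optimal)// -yx -(Gval_Gamma yG).
  set I := (\int[_]_b _)%E.
  have I0 : (0 <= I)%E by apply: integral_ge0 => b _; exact: value_ge0.
  have Ile : (I <= ((Gval e + M) / (1 - delta))%:E)%E.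
    exact: mean_value_le_Gval.
  have Ifin : I \is a fin_num.
    by rewrite ge0_fin_numE// (le_lt_trans Ile)// ltry.
  rewrite -(fineK Ifin) -EFinM -EFinD !lee_fin => GI.
  by rewrite ler_pdivrMr// mulrBr mulr1 lerBrDr mulrC.
move=> a; split => //; apply: (mean_value_max optimal).
(* The deviation to the absorbing [alphaI x] earns the upper bound. *)
have [x xG] := Gamma_nonempty u i lambda x0 a.
have xI := Gamma_XI xG.
rewrite (Gval_Gamma xG) -(value_absorbing optimal a xI (absorbing x xI)).
exact: mean_ge.
Qed.

Section destinations.
Hypothesis dest : forall a,
  smarg Pi a [set` zstar u a] = 1%E /\ kappa Pi a (destinations a) = 1%E.

Let optimal a : smarg Pi a [set` zstar u a] = 1%E.
Proof. by have [] := dest a. Qed.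

Let absorbing x : x \in XI u ->
  kappa Pi (alphaI R i x) [set alphaI R i x] = 1%E.
Proof.
by move=> xI; apply: alphaI_absorbing xI _; have [] := dest (alphaI R i x).
Qed.

(** Almost every next worldview is an absorbing destination, worth exactly the bound. *)
Lemma mean_value_destinations a :
  (\int[kappa_law Pi a]_b value a b = ((Gval a + M) / (1 - delta))%:E)%E.
Proof.
rewrite -[RHS](probability_integral_cst (kappa_law Pi a)).
have G0 : (0 <= ((Gval a + M) / (1 - delta))%:E)%E.
  apply: le_trans (value_le_Gval optimal a a).
  exact: value_ge0.
apply: ge0_ae_eq_integral => //.
- exact: measurable_value.
- by move=> b _; exact: value_ge0.
- have FP : Filter (almost_everywhere (kappa_law Pi a)) :=
    ae_filter_ringOfSetsType _.
  have mD := measurable_destinations a.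
  move: (probability1_ae (P := kappa_law Pi a) mD (dest a).2).
  apply: filterS => _ [x xG <-] _.
  have xI := Gamma_XI xG.
  by rewrite (value_absorbing optimal a xI (absorbing xI)) (Gval_Gamma xG).
Qed.

Lemma Sval_destinations a :
  Sval u lambda delta Pi a = (Gval a / (1 - delta))%:E.
Proof.
rewrite SvalE// mean_value_destinations -EFinB; congr (_%:E).
by rewrite mulrDl addrK.
Qed.

Lemma destinations_MPE : is_MPE u lambda delta Pi.
Proof.
move=> a; split => // c.
rewrite SvalE// CvalE// mean_value_destinations leeB//.
exact: value_le_Gval.
Qed.

Lemma ae_absorbed b : {ae path_law Pi b, forall w,
  (exists j, (w 1%N).1 = vertex R j) /\
  (forall t, (1 <= t)%N -> (w t).1 = (w 1%N).1)}.
Proof.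
have bP := path_lawP Pi b.
have FP : Filter (almost_everywhere (path_law Pi b)) :=
  ae_filter_ringOfSetsType _.
have mb : measurable [set w : sample_path R n x0 | (w 0%N).1 = b].
  apply: (@history_measurable _ _ _ _ 0).
  exact: history_state (measurable_worldview1 b).
have first_step : {ae path_law Pi b, forall w : sample_path R n x0,
    (w 0%N).1 = b -> destinations b (w 1%N).1}.
  apply: (ae_next 0 (E := [set b]) bP); first exact: measurable_worldview1.
    exact: measurable_destinations.
  by move=> _ ->; have [] := dest b.
have stay x t : {ae path_law Pi b, forall w : sample_path R n x0,
    x \in XI u -> (w t).1 = alphaI R i x -> (w t.+1).1 = alphaI R i x}.
  have [xI|nI] := boolP (x \in XI u); last by apply: nearW.
  have : {ae path_law Pi b, forall w : sample_path R n x0,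
      (w t).1 = alphaI R i x -> (w t.+1).1 = alphaI R i x}.
    have me := measurable_worldview1 (alphaI R i x).
    by apply: (ae_next t bP me me) => _ ->; exact: absorbing.
  by apply: filterS => w + _; exact.
(* Countably many times and finitely many actions: the exceptional sets merge into one null set. *)
have stays : {ae path_law Pi b, forall w : sample_path R n x0, forall t x,
    x \in XI u -> (w t).1 = alphaI R i x -> (w t.+1).1 = alphaI R i x}.
  by apply: ae_foralln => t; apply: filter_forall => x; exact: stay.
move: (probability1_ae mb bP.1) first_step stays.
apply: filterS3 => w /= w0 w1 wS.
have [x xG wx] := w1 w0; have xI := Gamma_XI xG.
split; first by exists (i x); rewrite -wx.
(* Time 0 is excluded and time 1 is trivial; induction runs from there. *)
elim=> [//|[|t] IH] _; first by [].
by rewrite -wx; apply: wS => //; rewrite wx; exact: IH.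
Qed.

(** A set containing no destination lies in the complement of the destinations, which is null. *)
Lemma randomization_support a (B : set (worldview R n)) :
  measurable B -> (0 < kappa Pi a B)%E ->
  exists2 x, x \in Gamma a & B (alphaI R i x).
Proof.
move=> mB kB; apply: contrapT => noB.
move: kB; apply/negP; rewrite -leNgt kappaE.
have <- : kappa_law Pi a (~` destinations a) = 0%E.
  rewrite probability_setC; last exact: measurable_destinations.
  by rewrite -kappaE (dest a).2 subee.
apply: le_measure; rewrite ?inE//.
  by apply: measurableC; exact: measurable_destinations.
by move=> c Bc [x xG xc]; apply: noB; exists x => //; rewrite xc.
Qed.

End destinations.
End equilibrium.

Theorem theorem9p2 (R : realType) (n : nat) (X : finType) (x0 : X)
    (u : 'I_n.+1 -> X -> R) (i : X -> 'I_n.+1) (lambda delta : R)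
    (Pi : strategy R n x0)
    (tailored : strictly_tailored u i)
    (lambda_gt : lambda_star u i < lambda) (lambda_lt1 : lambda < 1)
    (delta_gt0 : 0 < delta) (delta_lt1 : delta < 1) :
  (is_MPE u lambda delta Pi <->
   forall a : worldview R n,
     smarg Pi a [set` zstar u a] = 1%E /\
     kappa Pi a (alphaI R i @` [set` Gamma u i lambda a]) = 1%E) /\
  (is_MPE u lambda delta Pi ->
   (forall a : worldview R n,
      Sval u lambda delta Pi a = (Gval u i lambda a / (1 - delta))%:E) /\
   (forall b : worldview R n,
      {ae path_law Pi b, forall w,
         (exists j, (w 1%N).1 = vertex R j) /\
         (forall t, (1 <= t)%N -> (w t).1 = (w 1%N).1)}) /\
   (forall (a : worldview R n) (B : set (worldview R n)),
      measurable B -> (0 < kappa Pi a B)%E ->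
      exists2 x, x \in Gamma u i lambda a & B (alphaI R i x))).
Proof.
have MPE_dest :=
  MPE_destinations tailored lambda_gt lambda_lt1 delta_gt0 delta_lt1.
split.
  split; first exact: MPE_dest.
  exact: (destinations_MPE tailored lambda_gt lambda_lt1 delta_gt0 delta_lt1).
move=> /MPE_dest dest; split; [|split].
- exact: (Sval_destinations tailored lambda_gt lambda_lt1 delta_gt0 delta_lt1).
- exact: (ae_absorbed tailored lambda_gt).
- exact: (randomization_support dest).
Qed.
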